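(* Let $G=(V,E)$ be a minimally $d$-rigid graph with at least $d+1$ vertices and let $G'$ be obtained from $G$ by a $d$-dimensional vertex-split. Then $r_d(G')\ge 2r_d(G)$.
   Context: A $d$-dimensional vertex-split takes a graph $G$, a vertex $x$, and a partition of the neighbourhood of $x$ into sets $N_1$, $N_2$ and $\{w_1,\dots,w_{d-1}\}$; it outputs the graph obtained from $G-x$ by adding new vertices $x_1,x_2$, with $x_i$ joined to all of $N_i$ ($i=1,2$), both joined to each $w_j$, and the edge $x_1x_2$. On $\mathbb{R}^d$, $\|\cdot\|$ is the Euclidean norm. A realisation $p:V\to\mathbb{R}^d$ is generic if its coordinates are algebraically independent over $\mathbb{Q}$; realisations are equivalent if all edge lengths agree, congruent if related by an isometry. $G$ is $d$-rigid if some generic framework is rigid (every continuous edge-length-preserving motion is a congruence), minimally $d$-rigid if moreover $G-e$ is not $d$-rigid for all edges $e$. $r_d(G)$ is the maximum over generic $p:V\to\mathbb{R}^d$ of the number of congruence classes of real realisations equivalent to $p$. *)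

(* Defs.v *)
From HB Require Import structures.
From mathcomp Require Import all_boot all_order all_algebra.
From mathcomp Require Import mpoly.
From mathcomp Require Import all_classical all_reals all_analysis.
Set Implicit Arguments. Unset Strict Implicit. Unset Printing Implicit Defensive.
Import Order.TTheory GRing.Theory Num.Theory.
Import numFieldNormedType.Exports.
Local Open Scope ring_scope.

(* Simple graphs: a symmetric irreflexive relation on a finite vertex type
   (symmetry / irreflexivity are hypotheses of the theorem). *)

Definition del_edge (V : finType) (G : rel V) (u v : V) : rel V :=
  fun a b => G a b && ~~ (((a == u) && (b == v)) || ((a == v) && (b == u))).

(* d-dimensional vertex split of G at x with neighbourhood partition N1,N2,W.
   The new graph lives on option V: Some y = y for y <> x, Some x = x_1,
   None = x_2. *)
Definition vertex_split (V : finType) (G : rel V) (x : V) (N1 N2 W : {set V})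
  : rel (option V) :=
  fun a b => match a, b with
  | Some u, Some v =>
      if u == x then (v != x) && (v \in N1 :|: W)
      else if v == x then u \in N1 :|: W
      else G u v
  | Some u, None => if u == x then true else u \in N2 :|: W
  | None, Some v => if v == x then true else v \in N2 :|: W
  | None, None => false
  end.

Definition split_partition (V : finType) (G : rel V) (d : nat) (x : V)
  (N1 N2 W : {set V}) : Prop :=
  [/\ [disjoint N1 & N2], [disjoint N1 & W], [disjoint N2 & W],
      N1 :|: N2 :|: W = [set y | G x y] & #|W| = d.-1].

Section Frameworks.
Variable R : realType.
Variable d : nat.

Definition sqdist (a b : 'rV[R]_d) : R := \sum_(i < d) (a 0 i - b 0 i) ^+ 2.

Definition isometry (T : 'rV[R]_d -> 'rV[R]_d) : Prop :=
  forall a b, sqdist (T a) (T b) = sqdist a b.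

Variable V : finType.
Definition realisation := V -> 'rV[R]_d.

Definition coords (p : realisation) : 'I_(#|V| * d) -> R :=
  fun k => mxvec (\matrix_(i < #|V|, j < d) p (enum_val i) 0 j) 0 k.

Definition generic (p : realisation) : Prop :=
  forall q : mpoly.mpoly (#|V| * d) rat, q != 0 ->
    mpoly.mmap (fun c : rat => ratr c) (coords p) q != 0.

Definition equivalent (G : rel V) (p q : realisation) : Prop :=
  forall u v, G u v -> sqdist (p u) (p v) = sqdist (q u) (q v).

Definition congruent (p q : realisation) : Prop :=
  exists T, isometry T /\ forall v, q v = T (p v).

Definition rigid_fw (G : rel V) (p : realisation) : Prop :=
  forall f : R -> realisation,
    (forall v (i : 'I_d),
       {within (`[0, 1] : set R), continuous (fun t => f t v 0 i)}%classic) ->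
    f 0 = p ->
    (forall t, t \in `[0, 1] -> equivalent G p (f t)) ->
    forall t, t \in `[0, 1] -> congruent p (f t).

Definition d_rigid (G : rel V) : Prop :=
  exists p, generic p /\ rigid_fw G p.

Definition min_d_rigid (G : rel V) : Prop :=
  d_rigid G /\ forall u v, G u v -> ~ d_rigid (del_edge G u v).

Definition classes_ge (G : rel V) (p : realisation) (k : nat) : Prop :=
  exists q : 'I_k -> realisation,
    (forall i, equivalent G p (q i)) /\
    (forall i j, i != j -> ~ congruent (q i) (q j)).

(* k <= r_d(G), where r_d(G) is the supremum (in N u {oo}) over generic p *)
Definition rd_ge (G : rel V) (k : nat) : Prop :=
  exists p, generic p /\ classes_ge G p k.

End Frameworks.

(* Main.v *)
(** Let [p] be generic with pairwise non-congruent equivalent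
    realisations [q_1, ..., q_k] of [G]. Minimal rigidity makes the rigidity map
    of [G] a submersion at [p]; it is then a submersion at every [q_i], because
    genericity of [p] provides a derivation of the reals with any prescribed
    values on the coordinates of [p], and such a derivation transports
    velocities from [p] to [q_i]. Place [x_1] and [x_2] at [q x] and
    [q x + eps u]. After division by powers of [eps], the length equations of
    the split graph make sense at [eps = 0], where they say that [q] realises
    [G] with the lengths of [p] and that [u] is a unit vector normal to
    [q x - q w] for the [d - 1] vertices [w] of [W]. So [q_i] gives the two
    solutions [(q_i, n_i)] and [(q_i, - n_i)], both nondegenerate; hence all
    [2 k] of them persist for small [eps] and nearby right-hand sides, in
    particular for the edge lengths of a suitable generic realisation of the
    split graph. *)

From mathcomp Require Import (canonicals, coercions) mpoly.
Require Import Defs.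
From HB Require Import structures.
From mathcomp Require Import all_boot all_order all_algebra perm.
From mathcomp Require Import all_classical all_reals all_analysis.
From mathcomp Require Import ring lra.
Set Implicit Arguments. Unset Strict Implicit. Unset Printing Implicit Defensive.
Import Order.TTheory GRing.Theory Num.Theory.
Import numFieldNormedType.Exports.
Local Open Scope ring_scope.

(** * Extending derivations of a field *)

Section Derivations.
Variable K : numFieldType.

(** Rigidity is given only through continuous motions of one generic framework, while the submersion
    property is infinitesimal. The bridge is algebraic. At a generic rigid [p], the squared length
    of an edge is compared with the ring of rational polynomial values that are constant on all
    realisations having the same other edge lengths as [p]. If it is algebraic over this ring, it
    takes finitely many values, so it is constant along motions and the edge could be deleted.
    Otherwise some derivation moves this length and fixes the others, which excludes a stress on the
    edge. Since the graph becomes dependent when any nonedge is added, infinitesimal rigidity and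
    affine spanning follow without counting edges. The [q_i] need not be generic, so their
    nondegeneracy is not automatic: the equations for [u] are independent at [n_i] only if the
    vectors [q x - q w] are linearly independent, and this too is proved with derivations. Affine
    spanning is what keeps [n_i] and [- n_i] apart up to congruence. *)

Definition derivation (D : K -> K) : Prop :=
  (forall a b, D (a + b) = D a + D b) /\
  (forall a b, D (a * b) = D a * b + a * D b).

Lemma derivation0 D : derivation D -> D 0 = 0.
Proof. by move=> [DD _]; apply: (addrI (D 0)); rewrite -DD !addr0. Qed.

Lemma derivationB D a b : derivation D -> D (a - b) = D a - D b.
Proof. by move=> [DD _]; apply: (addIr (D b)); rewrite -DD !subrK. Qed.

(** The graph of a derivation on a subring of [K], kept as a relation so that unions of chains are
    immediate. Together with [pderB], the field [pder_fun] makes it single valued. *)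
Record partial_derivation (S : K -> K -> Prop) : Prop := PartialDerivation {
  pder1 : S 1 0;
  pderB : forall a a' b b', S a a' -> S b b' -> S (a - b) (a' - b');
  pderM : forall a a' b b', S a a' -> S b b' -> S (a * b) (a' * b + a * b');
  pder_fun : forall a', S 0 a' -> a' = 0 }.

Definition coef_rel (S : K -> K -> Prop) (g h : {poly K}) : Prop :=
  forall i, S g`_i h`_i.

(** The extension to the subring generated by [b] that sends [b] to [w]; here [h] is [g] with its
    coefficients differentiated. *)
Definition adjoin_der (S : K -> K -> Prop) (b w a a' : K) : Prop :=
  exists g h, [/\ coef_rel S g h, a = g.[b] & a' = h.[b] + g^`().[b] * w].

Section Extension.
Variable S : K -> K -> Prop.
Hypothesis Sder : partial_derivation S.

Lemma pder0 : S 0 0.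
Proof. by have := pderB Sder (pder1 Sder) (pder1 Sder); rewrite !subrr. Qed.

Lemma pderN a a' : S a a' -> S (- a) (- a').
Proof. by rewrite -sub0r -[- a']sub0r => ?; apply: (pderB Sder) => //; apply: pder0. Qed.

Lemma pderD a a' b b' : S a a' -> S b b' -> S (a + b) (a' + b').
Proof.
by move=> Sa /pderN Sb; rewrite -[b]opprK -[b']opprK; apply: (pderB Sder).
Qed.

Lemma pder_sum (n : nat) (F F' : 'I_n -> K) :
  (forall i, S (F i) (F' i)) -> S (\sum_i F i) (\sum_i F' i).
Proof.
by move=> SF; apply: (big_ind2 S) => //; [apply: pder0 | move=> *; apply: pderD].
Qed.

Lemma pderMn a a' n : S a a' -> S (a *+ n) (a' *+ n).
Proof.
move=> Sa; elim: n => [|n IH]; first by rewrite !mulr0n; apply: pder0.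
by rewrite !mulrS; apply: pderD.
Qed.

Lemma coef_relC a a' : S a a' -> coef_rel S a%:P a'%:P.
Proof. by move=> Sa i; rewrite !coefC; case: (i == 0)%N => //; apply: pder0. Qed.

Lemma coef_relX : coef_rel S 'X 0.
Proof.
by move=> i; rewrite coefX coef0; case: (i == 1)%N; [apply: (pder1 Sder) | apply: pder0].
Qed.

Lemma coef_relB g h g' h' :
  coef_rel S g h -> coef_rel S g' h' -> coef_rel S (g - g') (h - h').
Proof. by move=> Sg Sg' i; rewrite !coefB; apply: (pderB Sder). Qed.

Lemma coef_relM g h g' h' :
  coef_rel S g h -> coef_rel S g' h' -> coef_rel S (g * g') (h * g' + g * h').
Proof.
move=> Sg Sg' i; rewrite coefD !coefM -big_split /=; apply: pder_sum => j.
exact: (pderM Sder).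
Qed.

Lemma coef_relXn k : coef_rel S 'X^k 0.
Proof.
elim: k => [|k IH].
  by rewrite expr0; apply: (coef_relC (pder1 Sder)).
rewrite exprS; move: (coef_relM coef_relX IH).
by rewrite mul0r mulr0 addr0.
Qed.

Lemma coef_rel_deriv g h : coef_rel S g h -> coef_rel S g^`() h^`().
Proof. by move=> Sg i; rewrite !coef_deriv; apply: pderMn. Qed.

Lemma adjoin_der_partial b w :
  (forall g h, coef_rel S g h -> g.[b] = 0 -> h.[b] + g^`().[b] * w = 0) ->
  partial_derivation (adjoin_der S b w).
Proof.
move=> Hw; split.
- exists 1, 0; split; first exact: (coef_relC (pder1 Sder)).
    by rewrite hornerC.
  by rewrite horner0 derivC horner0 mul0r addr0.
- move=> _ _ _ _ [g [h [Sg -> ->]]] [g' [h' [Sg' -> ->]]].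
  exists (g - g'), (h - h'); split; first exact: coef_relB.
    by rewrite !hornerE.
  by rewrite derivB !hornerE; ring.
- move=> _ _ _ _ [g [h [Sg -> ->]]] [g' [h' [Sg' -> ->]]].
  exists (g * g'), (h * g' + g * h'); split; first exact: coef_relM.
    by rewrite !hornerE.
  by rewrite derivM !hornerE; ring.
- by move=> a' [g [h [Sg /esym g0 ->]]]; apply: Hw.
Qed.

Lemma adjoin_der_sub b w a a' : S a a' -> adjoin_der S b w a a'.
Proof.
move=> Sa; exists a%:P, a'%:P; split; first exact: coef_relC.
  by rewrite hornerC.
by rewrite derivC !hornerE ?mul0r ?addr0.
Qed.

Lemma adjoin_der_gen b w : adjoin_der S b w b w.
Proof.
exists 'X, 0; split; first exact: coef_relX.
  by rewrite hornerX.
by rewrite derivX !hornerE.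
Qed.

(** With no algebraic relation on [b] there is no constraint, so the slope [w] is free. *)
Lemma transcendental_slope b w :
  (forall g h, coef_rel S g h -> g.[b] = 0 -> g = 0) ->
  forall g h, coef_rel S g h -> g.[b] = 0 -> h.[b] + g^`().[b] * w = 0.
Proof.
move=> tr g h Sg gb0; have g0 := tr _ _ Sg gb0.
have -> : h = 0.
  apply/polyP=> i; rewrite coef0; apply: (pder_fun Sder).
  by have := Sg i; rewrite g0 coef0.
by rewrite g0 deriv0 !horner0 mul0r addr0.
Qed.

(* The slope at an algebraic [b] is forced by a minimal polynomial [g0] of [b];
   pseudo-division by [g0] shows that it is compatible with all other
   relations. *)
Lemma extension_slope b :
  exists w, forall g h, coef_rel S g h -> g.[b] = 0 -> h.[b] + g^`().[b] * w = 0.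
Proof.
pose P n := `[< exists g h, [/\ coef_rel S g h, g.[b] = 0, g != 0 & size g = n] >].
have [exP|nexP] := pselect (exists n, P n); last first.
  exists 0; apply: transcendental_slope => g h Sg gb0.
  apply/eqP/negPn/negP => gn0; apply: nexP; exists (size g).
  by apply/asboolP; exists g, h.
case: (ex_minnP exP) => n /asboolP[g0 [h0 [Sg0 g0b g0n0 szg0]]] minn.
have gmin g h : coef_rel S g h -> g.[b] = 0 -> (size g < n)%N -> g = 0.
  move=> Sg gb0; apply: contraTeq => gn0; rewrite -leqNgt; apply: minn.
  by apply/asboolP; exists g, h.
have n_gt1 : (1 < n)%N.
  rewrite -szg0 ltnNge; apply/negP => /size1_polyC g0C.
  by move: g0b g0n0; rewrite g0C hornerC => ->; rewrite eqxx.
(* In characteristic 0 the derivative of [g0] is nonzero; having smaller degree, it cannot vanish at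
   [b] by minimality. *)
have g0'b : g0^`().[b] != 0.
  apply/eqP=> g0'b0.
  have : g0^`() = 0.
    by apply: gmin (coef_rel_deriv Sg0) g0'b0 _; rewrite -szg0 lt_size_deriv.
  move/(congr1 (fun p : {poly K} => p`_(n.-2))); rewrite coef0 coef_deriv.
  have -> : (n.-2.+1 = (size g0).-1)%N by rewrite szg0; case: n n_gt1 {exP minn szg0 gmin} => [|[]].
  move/eqP; rewrite mulrn_eq0 -/(lead_coef g0) lead_coef_eq0 (negPf g0n0) orbF.
  by rewrite szg0; case: n n_gt1 {exP minn szg0 gmin} => [|[]].
pose w := - h0.[b] / g0^`().[b].
have Eg0 : h0.[b] + g0^`().[b] * w = 0 by rewrite /w; field.
move: w Eg0 => w Eg0; exists w => g; have [m] := ubnP (size g).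
elim: m g => // m IH g szg h Sg gb0.
have [ltn|len] := ltnP (size g) n.
  have gz := gmin _ _ Sg gb0 ltn.
  have -> : h = 0.
    apply/polyP=> i; rewrite coef0; apply: (pder_fun Sder).
    by have := Sg i; rewrite gz coef0.
  by rewrite gz deriv0 !horner0 mul0r addr0.
set c := lead_coef g0; set c' := h0`_(size g0).-1.
set l := lead_coef g; set l' := h`_(size g).-1.
have Scc : coef_rel S c%:P c'%:P by apply: coef_relC; apply: Sg0.
have Sll : coef_rel S l%:P l'%:P by apply: coef_relC; apply: Sg.
set k := (size g - n)%N.
(* The domain of [S] is only a ring, so [g] is multiplied by the leading coefficient [c] of [g0] to
   make the leading terms cancel. The slope equation for [g] is recovered at the end because [c] is
   nonzero. *)
have SG := coef_relB (coef_relM Scc Sg)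
  (coef_relM (coef_relM Sll (coef_relXn k)) Sg0).
set G := (X in coef_rel S X _) in SG; set H := (X in coef_rel S _ X) in SG.
have Gb : G.[b] = 0 by rewrite /G !hornerE gb0 g0b !mulr0 subrr.
have gn0 : (0 < size g)%N by apply: leq_trans len; apply: ltnW.
have szG : (size G < m)%N.
  have sg : (size g = (size g).-1.+1)%N by rewrite prednK.
  apply: (@leq_trans (size g)) => //; rewrite sg ltnS; apply/leq_sizeP => j lej.
  rewrite /G coefB coefCM -mulrA coefCM mulrC coefXnM.
  have kj : (j < k)%N = false.
    apply/negbTE; rewrite -leqNgt /k; apply: leq_trans lej.
    by case: (n) n_gt1 => // n' _; rewrite subnS -!subn1 leq_sub2r // leq_subr.
  rewrite kj; case: (ltnP (size g).-1 j) => [ltj|gej].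
    have j1 : (size g <= j)%N by rewrite sg.
    rewrite nth_default // [X in _ - l * X]nth_default ?mul0r ?mulr0 ?subr0 //.
    by rewrite szg0 /k leq_subRL ?(leq_trans (leq_subr _ _)) // subnK.
  have -> : j = (size g).-1 by apply/eqP; rewrite eqn_leq lej gej.
  have -> : ((size g).-1 - k = (size g0).-1)%N.
    by rewrite /k szg0 -!subn1 subnAC subKn.
  by rewrite -/(lead_coef g) -/(lead_coef g0) -/c -/l mulrC subrr.
have := IH _ szG _ SG Gb.
have -> : H.[b] + G^`().[b] * w =
  c * (h.[b] + g^`().[b] * w) - l * b ^+ k * (h0.[b] + g0^`().[b] * w).
  rewrite /H /G derivB !derivM !derivC !hornerE gb0 g0b; ring.
rewrite Eg0 mulr0 subr0 => /eqP; rewrite mulf_eq0 lead_coef_eq0 (negPf g0n0).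
by move/eqP.
Qed.

End Extension.

Lemma partial_derivation_extends S : partial_derivation S ->
  exists D, derivation D /\ forall a a', S a a' -> D a = a'.
Proof.
move=> Sder.
pose gr (A : set (K * K)) a a' := A (a, a').
pose P (A : set (K * K)) :=
  A = set0 \/ (partial_derivation (gr A) /\ forall a a', S a a' -> A (a, a')).
have S2P : P (fun z => S z.1 z.2).
  by right; split => //; case: Sder => *; split.
have [F FP Ftot|A [PA Amax]] := @Zorn_bigcup _ P.
  have [allF0|/existsNP[A0 /not_implyP[FA0 A0n0]]] :=
    pselect (forall A, F A -> A = set0).
    by left; rewrite -subset0 => z [A FA]; rewrite (allF0 _ FA).
  right.
  have FPn A z : F A -> A z -> partial_derivation (gr A) /\ forall a a', S a a' -> A (a, a').
    by move=> FA Az; case: (FP _ FA) => // E; rewrite E in Az.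
  have [A0d A0S] : partial_derivation (gr A0) /\ forall a a', S a a' -> A0 (a, a').
    by case: (FP _ FA0) => [E|//]; case: A0n0.
  have comm2 z z' : (\bigcup_(X in F) X)%classic z -> (\bigcup_(X in F) X)%classic z' ->
      exists A, [/\ F A, A z & A z'].
    move=> [A FA Az] [B FB Bz]; case: (Ftot _ _ FA FB) => sub.
      by exists B; split => //; apply: sub.
    by exists A; split => //; apply: sub.
  split; last by move=> a a' Sa; exists A0 => //; apply: A0S.
  split.
  - by exists A0 => //; apply: (pder1 A0d).
  - move=> a a' b b' Ua Ub; have [A [FA Aa Ab]] := comm2 _ _ Ua Ub.
    by exists A => //; have [Ad _] := FPn _ _ FA Aa; apply: (pderB Ad).
  - move=> a a' b b' Ua Ub; have [A [FA Aa Ab]] := comm2 _ _ Ua Ub.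
    by exists A => //; have [Ad _] := FPn _ _ FA Aa; apply: (pderM Ad).
  - by move=> a' [A FA Aa]; have [Ad _] := FPn _ _ FA Aa; apply: (pder_fun Ad).
have [Ad AS] : partial_derivation (gr A) /\ forall a a', S a a' -> A (a, a').
  case: PA => // A0; exfalso; apply: (Amax _ _ S2P).
  by rewrite A0 properEneq; split; [apply/eqP => /(congr1 (fun B => B (1, 0)));
     rewrite /= => E; have := pder1 Sder; rewrite -E | apply: sub0set].
have Atot b : exists w, A (b, w).
  have [w Hw] := extension_slope Ad b.
  have Bd := adjoin_der_partial Ad Hw.
  exists w; apply: contrapT => nAb.
  apply: (Amax (fun z => adjoin_der (gr A) b w z.1 z.2)).
    rewrite properEneq; split; last by move=> [a a'] Aa; apply: adjoin_der_sub.
    apply/eqP => E; apply: nAb; rewrite E; exact: adjoin_der_gen.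
  right; split; first by case: Bd => *; split.
  by move=> a a' Sa; apply: adjoin_der_sub => //; apply: AS.
have [D DP] := choice Atot.
have Duniq a a' : A (a, a') -> D a = a'.
  move=> Aa; apply/eqP; rewrite -subr_eq0; apply/eqP; apply: (pder_fun Ad).
  by rewrite -(subrr a); apply: (pderB Ad).
exists D; split; last by move=> a a' /AS /Duniq.
split=> a b; apply: Duniq.
  exact: (pderD Ad).
exact: (pderM Ad).
Qed.

End Derivations.

(** * Fixed points of contractions *)

Definition bounded_by (R : realType) (J : finType) (h : J -> R) (m : R) : Prop :=
  forall j, `|h j| <= m.

Section Contraction.
Variable R : realType.

Definition complete_rV (n : nat) : completeNormedModType R :=
  HB.pack_for (completeNormedModType R) 'rV[R]_n.

Lemma rV_normP n (v : 'rV[R]_n) m : 0 <= m ->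
  reflect (forall j, `|v 0 j| <= m) (`|v| <= m).
Proof.
move=> m0; apply: (iffP idP) => [vm j|vm].
  apply: le_trans vm.
  by rewrite [leRHS]/Num.Def.normr /= mx_normrE; apply/bigmax_geP; right; exists (0, j).
rewrite [leLHS]/Num.Def.normr /= mx_normrE (bigmax_le _ m0) //= => -[i j] _ /=.
by rewrite (ord1 i).
Qed.

Lemma contraction_fixpoint (I : finType) (Psi : (I -> R) -> I -> R) (rho : R) :
  0 < rho ->
  (forall z, bounded_by z rho -> bounded_by (Psi z) rho) ->
  (forall z z' m, 0 <= m -> bounded_by z rho -> bounded_by z' rho ->
     bounded_by (fun i => z i - z' i) m ->
     bounded_by (fun i => Psi z i - Psi z' i) (m / 2)) ->
  exists2 z, bounded_by z rho & forall i, Psi z i = z i.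
Proof.
move=> rho0 Pstab Plip.
pose X := complete_rV #|I|.
pose tofun (v : X) : I -> R := fun i => (v : 'rV[R]_#|I|) 0 (enum_rank i).
pose ofun (z : I -> R) : X := \row_k z (enum_val k).
pose f (v : X) : X := ofun (Psi (tofun v)).
pose U := [set v : X | `|v| <= rho]%classic.
have bndP (v : X) m : 0 <= m -> (`|v| <= m) <-> bounded_by (tofun v) m.
  move=> m0; split=> [/rV_normP H i|H]; first exact: H.
  apply/rV_normP => // k; have := H (enum_val k).
  by rewrite /tofun enum_valK.
have tofunK z : tofun (ofun z) = z.
  by apply/funext => i; rewrite /tofun mxE enum_rankK.
have tofunB (v w : X) : tofun (v - w) = (fun i => tofun v i - tofun w i).
  by apply/funext => i; rewrite /tofun !mxE.
have fU : set_fun U U f.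
  move=> v /bndP; rewrite /U /= => /(_ (ltW rho0)) vr.
  by apply/bndP; [exact: ltW | rewrite tofunK; apply: Pstab].
have [F FE] : exists F : {fun U >-> U}, F = f :> (X -> X).
  by exists (HB.pack_for {fun U >-> U} f (isFun.Build _ _ _ _ f fU)).
have ctr : is_contraction F.
  exists (2^-1)%:nng; split => /=; first by lra.
  move=> [v w] /= [Uv Uw]; rewrite FE mulrC.
  apply/bndP; first by rewrite mulr_ge0.
  have -> : tofun (f v - f w) =
      (fun i => Psi (tofun v) i - Psi (tofun w) i).
    by rewrite tofunB /f !tofunK.
  apply: Plip => //; first by apply/bndP => //; exact: ltW.
    by apply/bndP => //; exact: ltW.
  by rewrite -tofunB; apply/bndP.
have clU : closed U.
  have -> : U = (Num.Def.normr @^-1` [set x : R | x <= rho])%classic by [].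
  apply: closed_comp; last exact: closed_le.
  by move=> x _; exact: norm_continuous.
have U0 : (U !=set0)%classic.
  by exists 0; rewrite /U /= normr0 ltW.
have [v Uv vE] := banach_fixed_point ctr clU U0.
exists (tofun v); first by apply/bndP => //; exact: ltW.
by move=> i; rewrite [in RHS]vE FE /f tofunK.
Qed.

End Contraction.

(** * Polynomial functions *)

Section PolynomialFunctions.
Variables (R : realType) (J : finType).
Implicit Types (f g : (J -> R) -> R) (df dg : (J -> R) -> (J -> R) -> R).

(* [df x h] is the differential of [f] at [x] applied to [h]. *)
Inductive polyfun (C : R -> Prop) :
    ((J -> R) -> R) -> ((J -> R) -> (J -> R) -> R) -> Prop :=
| polyfun_cst c : C c -> polyfun C (fun=> c) (fun _ _ => 0)
| polyfun_var j : polyfun C (fun x => x j) (fun _ h => h j)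
| polyfun_add f df g dg : polyfun C f df -> polyfun C g dg ->
    polyfun C (fun x => f x + g x) (fun x h => df x h + dg x h)
| polyfun_mul f df g dg : polyfun C f df -> polyfun C g dg ->
    polyfun C (fun x => f x * g x) (fun x h => df x h * g x + f x * dg x h).

Definition rational (c : R) : Prop := exists r : rat, c = ratr r.
Definition any (c : R) : Prop := True.

Lemma rational_nat n : rational n%:R.
Proof. by exists n%:R; rewrite ratr_nat. Qed.

Lemma rationalN1 : rational (-1).
Proof. by exists (-1); rewrite rmorphN1. Qed.

Lemma polyfun_any C f df : polyfun C f df -> polyfun any f df.
Proof. by elim=> *; constructor. Qed.

Lemma polyfun_eq C f df f' df' : polyfun C f df ->
  (forall x, f' x = f x) -> (forall x h, df' x h = df x h) -> polyfun C f' df'.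
Proof.
move=> pf /funext -> E; suff -> : df' = df by [].
by apply/funext => x; apply/funext => h.
Qed.

Lemma polyfun_sub f df g dg : polyfun rational f df -> polyfun rational g dg ->
  polyfun rational (fun x => f x - g x) (fun x h => df x h - dg x h).
Proof.
move=> pf pg.
apply: polyfun_eq (polyfun_add pf (polyfun_mul (polyfun_cst rationalN1) pg)) _ _.
  by move=> x; rewrite mulN1r.
by move=> x h; rewrite mul0r add0r mulN1r.
Qed.

Lemma polyfun_sqr C f df : polyfun C f df ->
  polyfun C (fun x => f x ^+ 2) (fun x h => 2 * (f x * df x h)).
Proof.
move=> pf; apply: polyfun_eq (polyfun_mul pf pf) _ _.
  by move=> x; rewrite expr2.
by move=> x h; ring.
Qed.

Lemma polyfun_sum (I : Type) (s : seq I) (F : I -> (J -> R) -> R) dF :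
  (forall i, polyfun rational (F i) (dF i)) ->
  polyfun rational (fun x => \sum_(i <- s) F i x) (fun x h => \sum_(i <- s) dF i x h).
Proof.
move=> pF; elim: s => [|i s IH].
  apply: polyfun_eq (polyfun_cst (rational_nat 0)) _ _ => *; exact: big_nil.
by apply: polyfun_eq (polyfun_add (pF i) IH) _ _ => *; rewrite big_cons.
Qed.

Lemma polyfun_prod (I : Type) (s : seq I) (F : I -> (J -> R) -> R) :
  (forall i, exists dF, polyfun rational (F i) dF) ->
  exists dF, polyfun rational (fun x => \prod_(i <- s) F i x) dF.
Proof.
move=> pF; elim: s => [|i s [dF pd]].
  exists (fun _ _ => 0).
  by apply: polyfun_eq (polyfun_cst (rational_nat 1)) _ _ => // x; rewrite big_nil.
have [di pi] := pF i; eexists.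
by apply: polyfun_eq (polyfun_mul pi pd) _ _ => // x; rewrite big_cons.
Qed.

Section LinearDifferential.
Variables (C : R -> Prop) (f : (J -> R) -> R) (df : (J -> R) -> (J -> R) -> R).
Hypothesis pf : polyfun C f df.

Lemma polyfun_dD x h k : df x (fun j => h j + k j) = df x h + df x k.
Proof.
by elim: pf => [c _|j|? ? ? ? _ IHf _ IHg|? ? ? ? _ IHf _ IHg];
  rewrite ?addr0 ?IHf ?IHg //; ring.
Qed.

Lemma polyfun_dZ x c h : df x (fun j => c * h j) = c * df x h.
Proof.
by elim: pf => [? _|j|? ? ? ? _ IHf _ IHg|? ? ? ? _ IHf _ IHg];
  rewrite ?mulr0 ?IHf ?IHg //; ring.
Qed.

Lemma polyfun_d_sum (I : Type) (s : seq I) (z : I -> R) (H : I -> J -> R) x :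
  df x (fun j => \sum_(i <- s) z i * H i j) = \sum_(i <- s) z i * df x (H i).
Proof.
elim: s => [|i s IH].
  rewrite big_nil -[RHS](mul0r (df x (fun=> 0))) -polyfun_dZ.
  by congr (df x _); apply/funext => j; rewrite big_nil mul0r.
rewrite big_cons -IH -polyfun_dZ -polyfun_dD; congr (df x _).
by apply/funext => j; rewrite big_cons.
Qed.

Lemma polyfun_line x h : exists g : {poly R},
  (forall t, f (fun j => x j + t * h j) = g.[t]) /\ g^`().[0] = df x h.
Proof.
elim: pf => [c _|j|f1 d1 f2 d2 _ [g1 [e1 E1]] _ [g2 [e2 E2]]
            |f1 d1 f2 d2 _ [g1 [e1 E1]] _ [g2 [e2 E2]]].
- by exists c%:P; split=> [t|]; rewrite ?hornerC // derivC horner0.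
- exists ((x j)%:P + h j *: 'X); split=> [t|]; first by rewrite !hornerE mulrC.
  by rewrite derivD derivC derivZ derivX !hornerE.
- exists (g1 + g2); split=> [t|]; first by rewrite e1 e2 hornerD.
  by rewrite derivD hornerD E1 E2.
- exists (g1 * g2); split=> [t|]; first by rewrite e1 e2 hornerM.
  have x0 : (fun j => x j + 0 * h j) = x.
    by apply/funext => j; rewrite mul0r addr0.
  by rewrite derivM hornerD !hornerM E1 E2 -e1 -e2 x0.
Qed.

(** On a line [f] is a univariate polynomial, here with more roots than its degree. Consequently the
    differential depends only on the function, not on the expression that built it. *)
Lemma polyfun_vanish : (forall x, f x = 0) -> forall x h, df x h = 0.
Proof.
move=> f0 x h; have [g [gE <-]] := polyfun_line x h.
suff -> : g = 0 by rewrite deriv0 horner0.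
apply/eqP; apply: contraT => gn0.
pose s := [seq (n%:R : R) | n <- iota 0 (size g)].
have uniq_s : uniq s.
  by rewrite map_inj_uniq ?iota_uniq // => a b /eqP; rewrite eqr_nat => /eqP.
have roots_s : all (root g) s.
  by apply/allP => _ /mapP[n _ ->]; rewrite /root -gE f0.
by have := max_poly_roots gn0 roots_s uniq_s; rewrite size_map size_iota ltnn.
Qed.

(** Both points [a] and [b] vary, since the contraction argument needs an error that is small
    relative to their distance. The bound [B] on the differential is carried along for the product
    case. *)
Lemma polyfun_strict_derivative x0 : exists2 B, 0 <= B &
  (forall h m, 0 <= m -> bounded_by h m -> `|df x0 h| <= B * m) /\
  (forall e, 0 < e -> exists2 delta, 0 < delta & forall a b m, 0 <= m ->
    bounded_by (fun j => a j - x0 j) delta ->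
    bounded_by (fun j => b j - x0 j) delta ->
    bounded_by (fun j => a j - b j) m ->
    `|f a - f b - df x0 (fun j => a j - b j)| <= e * m).
Proof.
elim: pf => [c _|j|f1 d1 f2 d2 p1 [B1 B10 [b1 s1]] p2 [B2 B20 [b2 s2]]
            |f1 d1 f2 d2 p1 [B1 B10 [b1 s1]] p2 [B2 B20 [b2 s2]]].
- exists 0 => //; split=> [h m _ _|e e0]; first by rewrite normr0 mul0r.
  by exists 1 => // a b m m0 _ _ _; rewrite !subrr normr0 mulr_ge0 // ltW.
- exists 1 => //; split=> [h m _ /(_ j)|e e0]; first by rewrite mul1r.
  by exists 1 => // a b m m0 _ _ _; rewrite !subrr normr0 mulr_ge0 // ltW.
- exists (B1 + B2); first exact: addr_ge0.
  split=> [h m m0 hm|e e0].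
    by rewrite mulrDl (le_trans (ler_normD _ _)) // lerD // ?b1 ?b2.
  have e20 : 0 < e / 2 by lra.
  have [t1 t10 H1] := s1 _ e20; have [t2 t20 H2] := s2 _ e20.
  exists (Num.min t1 t2); first by rewrite lt_min t10.
  move=> a b m m0 ha hb hab.
  have le1 : Num.min t1 t2 <= t1 by rewrite ge_min lexx.
  have le2 : Num.min t1 t2 <= t2 by rewrite ge_min lexx orbT.
  have A1 := H1 _ _ _ m0 (fun j => le_trans (ha j) le1) (fun j => le_trans (hb j) le1) hab.
  have A2 := H2 _ _ _ m0 (fun j => le_trans (ha j) le2) (fun j => le_trans (hb j) le2) hab.
  set u := d1 _ _ in A1 *; set v := d2 _ _ in A2 *.
  have -> : f1 a + f2 a - (f1 b + f2 b) - (u + v) =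
    (f1 a - f1 b - u) + (f2 a - f2 b - v) by ring.
  apply: le_trans (ler_normD _ _) _; lra.
set M1 := `|f1 x0|; set M2 := `|f2 x0|.
have M10 : 0 <= M1 := normr_ge0 _.
have M20 : 0 <= M2 := normr_ge0 _.
exists (B1 * M2 + M1 * B2); first by rewrite addr_ge0 // mulr_ge0.
split=> [h m m0 hm|e e0].
  rewrite (le_trans (ler_normD _ _)) // !normrM mulrDl lerD //.
    by rewrite mulrAC ler_wpM2r // b1.
  by rewrite -mulrA ler_wpM2l // b2.
(* Near [x0] the factors are bounded by [M1 + B1 + 1] and [M2 + B2 + 1]; with this [K], each of the
   four terms of the product error is at most [e / 4 * m]. *)
pose K := 4 * ((M1 + B1 + 1) * (M2 + B2 + 1)).
have K1 : 1 <= (M1 + B1 + 1) * (M2 + B2 + 1) by nra.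
have K0 : 0 < K by rewrite /K; lra.
have eK0 : 0 < e / K by rewrite divr_gt0.
have KM1 : (M1 + B1 + 1) <= K / 4 by rewrite /K; nra.
have KM2 : (M2 + B2 + 1) <= K / 4 by rewrite /K; nra.
have eKE : (e / K) * K = e by rewrite divfK // gt_eqF.
have [t1 t10 H1] := s1 _ (ltr01 : 0 < 1 :> R).
have [t2 t20 H2] := s2 _ (ltr01 : 0 < 1 :> R).
have [t3 t30 H3] := s1 _ eK0; have [t4 t40 H4] := s2 _ eK0.
pose dl := Num.min 1 (Num.min (e / K) (Num.min (Num.min t1 t2) (Num.min t3 t4))).
have dl0 : 0 < dl by rewrite !lt_min ltr01 eK0 t10 t20 t30 t40.
have [dl1 dlK dlt1 dlt2 dlt3] : [/\ dl <= 1, dl <= e / K, dl <= t1, dl <= t2 & dl <= t3].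
  by split; rewrite !ge_min lexx ?orbT.
have dlt4 : dl <= t4 by rewrite !ge_min lexx ?orbT.
exists dl => // a b m m0 ha hb hab.
have hx : bounded_by (fun j => x0 j - x0 j) dl by move=> j; rewrite subrr normr0 ltW.
have mono t (h : J -> R) : dl <= t -> bounded_by h dl -> bounded_by h t.
  by move=> lt hh j; apply: le_trans lt.
have A1 := H3 _ _ _ m0 (mono _ _ dlt3 ha) (mono _ _ dlt3 hb) hab.
have A2 := H4 _ _ _ m0 (mono _ _ dlt4 ha) (mono _ _ dlt4 hb) hab.
have A3 := H1 _ _ _ (ltW dl0) (mono _ _ dlt1 hb) (mono _ _ dlt1 hx) hb.
have A4 := H2 _ _ _ (ltW dl0) (mono _ _ dlt2 ha) (mono _ _ dlt2 hx) ha.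
have C1 := b1 _ _ m0 hab; have C2 := b2 _ _ m0 hab.
have C3 := b1 _ _ (ltW dl0) hb; have C4 := b2 _ _ (ltW dl0) ha.
set u := d1 x0 _ in A1 C1 *; set v := d2 x0 _ in A2 C2 *.
have G1 : `|f1 b - f1 x0| <= (B1 + 1) * dl.
  have -> : f1 b - f1 x0 = (f1 b - f1 x0 - d1 x0 (fun j => b j - x0 j)) + d1 x0 (fun j => b j - x0 j).
    by rewrite subrK.
  apply: le_trans (ler_normD _ _) _; lra.
have G2 : `|f2 a - f2 x0| <= (B2 + 1) * dl.
  have -> : f2 a - f2 x0 = (f2 a - f2 x0 - d2 x0 (fun j => a j - x0 j)) + d2 x0 (fun j => a j - x0 j).
    by rewrite subrK.
  apply: le_trans (ler_normD _ _) _; lra.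
have G3 : `|f1 b| <= M1 + B1 + 1.
  have -> : f1 b = f1 x0 + (f1 b - f1 x0) by rewrite addrC subrK.
  apply: le_trans (ler_normD _ _) _; rewrite -/M1; nra.
have G4 : `|f2 a| <= M2 + B2 + 1.
  have -> : f2 a = f2 x0 + (f2 a - f2 x0) by rewrite addrC subrK.
  apply: le_trans (ler_normD _ _) _; rewrite -/M2; nra.
have -> : f1 a * f2 a - f1 b * f2 b - (u * f2 x0 + f1 x0 * v) =
  (f1 a - f1 b - u) * f2 a + u * (f2 a - f2 x0)
  + (f1 b * (f2 a - f2 b - v) + (f1 b - f1 x0) * v) by ring.
have T1 : `|(f1 a - f1 b - u) * f2 a| <= (e / K * m) * (K / 4).
  by rewrite normrM ler_pM // (le_trans G4).
have T3 : `|f1 b * (f2 a - f2 b - v)| <= (K / 4) * (e / K * m).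
  by rewrite normrM ler_pM // (le_trans G3).
have T2 : `|u * (f2 a - f2 x0)| <= (B1 * m) * ((B2 + 1) * (e / K)).
  rewrite normrM ler_pM // (le_trans G2) // ler_wpM2l //; lra.
have T4 : `|(f1 b - f1 x0) * v| <= ((B1 + 1) * (e / K)) * (B2 * m).
  rewrite normrM ler_pM // (le_trans G1) // ler_wpM2l //; lra.
have F1 : (B1 * m) * ((B2 + 1) * (e / K)) <= e / 4 * m.
  have -> : (B1 * m) * ((B2 + 1) * (e / K)) = (B1 * (B2 + 1)) * (e / K * m) by ring.
  rewrite -{2}eKE.
  have -> : e / K * K / 4 * m = K / 4 * (e / K * m) by ring.
  apply: ler_wpM2r; first by rewrite mulr_ge0 // ltW.
  by rewrite /K; nra.
have F2 : ((B1 + 1) * (e / K)) * (B2 * m) <= e / 4 * m.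
  have -> : ((B1 + 1) * (e / K)) * (B2 * m) = ((B1 + 1) * B2) * (e / K * m) by ring.
  rewrite -{2}eKE.
  have -> : e / K * K / 4 * m = K / 4 * (e / K * m) by ring.
  apply: ler_wpM2r; first by rewrite mulr_ge0 // ltW.
  by rewrite /K; nra.
have F3 : e / K * m * (K / 4) = e / 4 * m by rewrite -{2}eKE; ring.
apply: le_trans (ler_normD _ _) _.
apply: le_trans (lerD (ler_normD _ _) (ler_normD _ _)) _.
lra.
Qed.

Lemma polyfun_continuous x0 e : 0 < e -> exists2 delta, 0 < delta &
  forall a, bounded_by (fun j => a j - x0 j) delta -> `|f a - f x0| <= e.
Proof.
move=> e0; have [B B0 [bB sB]] := polyfun_strict_derivative x0.
have [t t0 Ht] := sB _ (ltr01 : 0 < 1 :> R).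
have eB : 0 < e / (B + 1) by rewrite divr_gt0 //; lra.
exists (Num.min t (e / (B + 1))); first by rewrite lt_min t0.
set dl := Num.min _ _ => a ha.
have dl0 : 0 <= dl by rewrite /dl le_min !ltW.
have dt : dl <= t by rewrite /dl ge_min lexx.
have dB : dl <= e / (B + 1) by rewrite /dl ge_min lexx orbT.
have hx : bounded_by (fun j => x0 j - x0 j) t by move=> j; rewrite subrr normr0 ltW.
have A := Ht _ _ _ dl0 (fun j => le_trans (ha j) dt) hx ha.
have A' := bB _ _ dl0 ha.
have -> : f a - f x0 = (f a - f x0 - df x0 (fun j => a j - x0 j)) + df x0 (fun j => a j - x0 j).
  by rewrite subrK.
apply: le_trans (ler_normD _ _) _.
have : (B + 1) * dl <= e.
  by rewrite mulrC -ler_pdivlMr //; lra.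
lra.
Qed.

End LinearDifferential.

End PolynomialFunctions.

(** * Local right inverses *)

Lemma fin_radius (R : realType) (I : finType) (P : I -> R -> Prop) :
  (forall i a b, 0 < a -> a <= b -> P i b -> P i a) ->
  (forall i, exists2 a, 0 < a & P i a) ->
  exists2 a, 0 < a & forall i, P i a.
Proof.
move=> Pmono exP.
have [a aP] : exists a : I -> R, forall i, 0 < a i /\ P i (a i).
  have [|a aP] := @choice _ _ (fun i a => 0 < a /\ P i a); last by exists a.
  by move=> i; have [a] := exP i; exists a.
have a0 i : 0 < a i by have [] := aP i.
have b0 : 0 < \big[Num.min/1]_i a i :> R by apply: lt_bigmin => // i _; exact: a0.
exists (\big[Num.min/1]_i a i) => // i; apply: Pmono (b0) _ (_ : P i (a i)); last by have [] := aP i.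
exact: bigmin_le_cond.
Qed.

Section LocalInverse.
Variables (R : realType) (I J : finType).
Variables (F : I -> (J -> R) -> R) (dF : I -> (J -> R) -> (J -> R) -> R).
Hypothesis pF : forall i, polyfun (@any R) (F i) (dF i).
Variable x0 : J -> R.
Hypothesis dF_surj :
  forall i, exists h, forall i', dF i' x0 h = (i' == i)%:R.

(* Precomposing [F] with a linear right inverse of its differential gives a map
   [G] whose strict derivative at 0 is the identity, so that
   [z |-> z - G z + y] is a contraction near 0. *)
Lemma local_right_inverse r : 0 < r ->
  exists2 delta, 0 < delta & exists2 C, 0 <= C & exists s : (I -> R) -> J -> R,
  [/\ s (fun i => F i x0) = x0,
    (forall y, bounded_by (fun i => y i - F i x0) delta ->
       (forall i, F i (s y) = y i) /\ bounded_by (fun j => s y j - x0 j) r) &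
    (forall y y' m, 0 <= m -> bounded_by (fun i => y i - F i x0) delta ->
       bounded_by (fun i => y' i - F i x0) delta ->
       bounded_by (fun i => y i - y' i) m ->
       bounded_by (fun j => s y j - s y' j) (C * m))].
Proof.
move=> r0; have [H HE] := choice dF_surj.
pose M := 1 + \sum_j \sum_i `|H i j|.
have sumM j : \sum_i `|H i j| <= M.
  rewrite /M (bigD1 j) //= addrCA lerDl addr_ge0 // sumr_ge0 // => *.
  exact: sumr_ge0.
have M0 : 0 < M by rewrite /M ltr_wpDr ?ltr01 // sumr_ge0 // => *; exact: sumr_ge0.
pose A (z : I -> R) : J -> R := fun j => \sum_i z i * H i j.
have Abnd z m : 0 <= m -> bounded_by z m -> bounded_by (A z) (M * m).
  move=> m0 zm j; apply: le_trans (ler_norm_sum _ _ _) _.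
  apply: (@le_trans _ _ (\sum_i m * `|H i j|)).
    by apply: ler_sum => i _; rewrite normrM ler_wpM2r.
  by rewrite -mulr_sumr mulrC ler_wpM2r.
have AB z z' : A (fun i => z i - z' i) = (fun j => A z j - A z' j).
  by apply/funext => j; rewrite /A -sumrB; apply: eq_bigr => i _; rewrite mulrBl.
have dFA i z : dF i x0 (A z) = z i.
  rewrite (polyfun_d_sum (pF i)) (bigD1 i) //= HE eqxx mulr1 big1 ?addr0 // => i' ii'.
  by rewrite HE eq_sym (negPf ii') mulr0.
pose pt z : J -> R := fun j => x0 j + A z j.
pose G z i := F i (pt z).
(* The right inverse [A] stretches by at most [M], so an error rate of [1 / (2 * M)] for [F] leaves
   the rate [1 / 2] for [G]. *)
have e0 : 0 < (2 * M)^-1 by rewrite invr_gt0; lra.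
have [t t0 Ht] : exists2 t, 0 < t & forall i a b m, 0 <= m ->
    bounded_by (fun j => a j - x0 j) t -> bounded_by (fun j => b j - x0 j) t ->
    bounded_by (fun j => a j - b j) m ->
    `|F i a - F i b - dF i x0 (fun j => a j - b j)| <= (2 * M)^-1 * m.
  apply: fin_radius => [i a b _ ab H' a' b' m m0 ha hb|i].
    by apply: H' => // j; [apply: le_trans (ha j) ab | apply: le_trans (hb j) ab].
  by have [B _ [_ /(_ _ e0)]] := polyfun_strict_derivative (pF i) x0.
pose rho := Num.min t r / M.
have rho0 : 0 < rho by rewrite divr_gt0 // lt_min t0.
have Mrho : M * rho = Num.min t r by rewrite mulrC divfK // gt_eqF.
have ptx z : (fun j => pt z j - x0 j) = A z.
  by apply/funext => j; rewrite /pt addrC addKr.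
have ptB z z' : (fun j => pt z j - pt z' j) = A (fun i => z i - z' i).
  by rewrite AB; apply/funext => j; rewrite /pt; ring.
have ptbnd z : bounded_by z rho -> bounded_by (fun j => pt z j - x0 j) (Num.min t r).
  by rewrite ptx -Mrho; apply: Abnd; exact: ltW.
have Gdiff z z' m : 0 <= m -> bounded_by z rho -> bounded_by z' rho ->
    bounded_by (fun i => z i - z' i) m ->
    forall i, `|G z i - G z' i - (z i - z' i)| <= m / 2.
  move=> m0 hz hz' hzz i.
  have tmin : Num.min t r <= t by rewrite ge_min lexx.
  have := Ht i (pt z) (pt z') (M * m) (mulr_ge0 (ltW M0) m0)
    (fun j => le_trans (ptbnd z hz j) tmin) (fun j => le_trans (ptbnd z' hz' j) tmin).
  rewrite ptB dFA => /(_ (Abnd _ _ m0 hzz)).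
  suff -> : (2 * M)^-1 * (M * m) = m / 2 by [].
  by field; rewrite gt_eqF.
have pt0 : pt (fun=> 0) = x0.
  apply/funext => j; rewrite /pt /A big1 ?addr0 // => i _; exact: mul0r.
have b0 : @bounded_by R I (fun=> 0) rho.
  by move=> i; rewrite normr0 ltW.
have Gsolve y : bounded_by (fun i => y i - F i x0) (rho / 2) ->
    exists z, bounded_by z rho /\ forall i, G z i = y i.
  move=> hy.
  have [||z zb zE] := @contraction_fixpoint R I (fun z i => z i - G z i + y i) rho rho0.
  - move=> z hz i.
    have hz0 : bounded_by (fun i => z i - 0) rho by move=> k; rewrite subr0.
    have := Gdiff z (fun=> 0) rho (ltW rho0) hz b0 hz0 i.
    rewrite subr0 /G pt0 => D; have := hy i => D'.
    have -> : z i - F i (pt z) + y i = - (F i (pt z) - F i x0 - z i) + (y i - F i x0) by ring.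
    apply: le_trans (ler_normD _ _) _; rewrite normrN; lra.
  - move=> z z' m m0 hz hz' hzz i.
    have := Gdiff z z' m m0 hz hz' hzz i.
    rewrite -normrN; congr (`|_| <= _); ring.
  - exists z; split => // i; have := zE i; lra.
have [S SP] : {S : (I -> R) -> I -> R &
    forall y, bounded_by (fun i => y i - F i x0) (rho / 2) ->
      bounded_by (S y) rho /\ forall i, G (S y) i = y i}.
  apply: (@choice _ _ (fun y z => bounded_by (fun i => y i - F i x0) (rho / 2) ->
      bounded_by z rho /\ forall i, G z i = y i)) => y.
  have [/Gsolve[z Hz]|nb] := pselect (bounded_by (fun i => y i - F i x0) (rho / 2)).
    by exists z.
  by exists (fun=> 0).
(* At an index where [|z i - z' i|] is maximal, [G] loses at most half of that difference, so it is
   injective with a 2-Lipschitz inverse. This gives both that [s] returns [x0] and the constant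
   [2 * M]. *)
have Sinj z z' m : 0 <= m -> bounded_by z rho -> bounded_by z' rho ->
    bounded_by (fun i => G z i - G z' i) m -> bounded_by (fun i => z i - z' i) (2 * m).
  move=> m0 hz hz' hG i0.
  have [i _ imax] := @arg_maxP _ _ _ i0 xpredT (fun i => `|z i - z' i|) isT.
  have hb : bounded_by (fun i => z i - z' i) `|z i - z' i| by move=> k; exact: imax.
  apply: le_trans (imax i0 isT) _.
  have D := Gdiff z z' _ (normr_ge0 _) hz hz' hb i.
  have D' := hG i.
  have : `|z i - z' i| <= `|G z i - G z' i - (z i - z' i)| + `|G z i - G z' i|.
    rewrite [leRHS]addrC; apply: le_trans (ler_normB _ _).
    by rewrite le_eqVlt; apply/orP; left; apply/eqP; congr `|_|; ring.
  lra.
exists (rho / 2); first by rewrite divr_gt0.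
exists (2 * M); first by rewrite mulr_ge0 // ltW.
exists (fun y => pt (S y)); split.
- have hb : bounded_by (fun i => F i x0 - F i x0) (rho / 2).
    by move=> i; rewrite subrr normr0 divr_ge0 // ltW.
  have [Sb SE] := SP (fun i => F i x0) hb.
  rewrite -[RHS]pt0; congr pt; apply/funext => i; apply/eqP; rewrite -subr_eq0 -normr_le0.
  have := Sinj _ _ 0 (lexx _) Sb b0 _ i; rewrite mulr0; apply => k.
  by rewrite SE /G pt0 subrr normr0.
- move=> y hy; have [Sb SE] := SP y hy; split=> // j.
  by apply: le_trans (ptbnd _ Sb j) _; rewrite ge_min lexx orbT.
- move=> y y' m m0 hy hy' hyy; have [Sb SE] := SP y hy; have [Sb' SE'] := SP y' hy'.
  rewrite ptB -mulrA mulrCA; apply: Abnd; first by rewrite mulr_ge0.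
  apply: Sinj => // i; rewrite SE SE'; exact: hyy.
Qed.

End LocalInverse.

(** * Algebraically independent points *)

Lemma roots_seq (F : fieldType) (p : {poly F}) : p != 0 ->
  exists s : seq F, forall t, root p t -> t \in s.
Proof.
have [n] := ubnP (size p); elim: n p => // n IH p szp pn0.
have [[a pa]|nr] := pselect (exists a, root p a); last first.
  by exists [::] => t pt; case: nr; exists t.
have [q pE] := factor_theorem p a pa.
have qn0 : q != 0 by apply: contraNneq pn0 => q0; rewrite pE q0 mul0r.
have [|s sP] := IH q _ qn0.
  by move: szp; rewrite pE size_Mmonic ?monicXsubC // size_XsubC addn2 /= ltnS.
exists (a :: s) => t; rewrite pE rootM root_XsubC inE => /orP[/sP ->|->] //.
by rewrite orbT.
Qed.

Lemma interval_avoid_countable (R : realType) (A : set R) (a b : R) :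
  countable A -> a < b -> exists2 t, a <= t <= b & ~ A t.
Proof.
move=> cA ab; apply: contrapT => nex.
have sub : (`[a, b] `<=` A)%classic.
  move=> t; rewrite /= in_itv /= => tab; apply: contrapT => nAt.
  by apply: nex; exists t.
have := countable_lebesgue_measure0 (sub_countable (subset_card_le sub) cA).
rewrite lebesgue_measure_itv /= lte_fin ab -EFinD => /eqP.
by rewrite eqe subr_eq0 => /eqP E; move: ab; rewrite E ltxx.
Qed.

Section MultivariatePolynomials.

Variables (R : realType) (N : nat).
Local Notation poly_rat := (mpoly.mpoly N rat).
Local Notation ev x P := (mpoly.mmap (fun c : rat => ratr c : R) x P).

Lemma mpoly_ring_ind (K : poly_rat -> Prop) :
  (forall c, K (mpoly.mpolyC N c)) -> (forall i, K (mpoly.mpolyX rat (mpoly.mnm1 i))) ->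
  (forall P Q, K P -> K Q -> K (P + Q)) -> (forall P Q, K P -> K Q -> K (P * Q)) ->
  forall P, K P.
Proof.
move=> KC KX KD KM; elim/mpoly.mpolyind => [|c m P _ _ KP].
  by rewrite -(mpoly.mpolyC0 N rat); exact: KC.
apply: KD => //; rewrite -mpoly.mul_mpolyC; apply: (KM) => //.
rewrite mpoly.mpolyXE_id; apply: (big_ind K) => [||i _]; last 1 first.
- elim: (m i) => [|k IH]; first by rewrite expr0 -(mpoly.mpolyC1 N rat); exact: KC.
  by rewrite exprS; apply: (KM).
- by rewrite -(mpoly.mpolyC1 N rat); exact: KC.
- exact: KM.
Qed.

Lemma evD (x : 'I_N -> R) (P Q : poly_rat) : ev x (P + Q) = ev x P + ev x Q.
Proof. exact: mpoly.mmapD. Qed.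

Lemma evM (x : 'I_N -> R) (P Q : poly_rat) : ev x (P * Q) = ev x P * ev x Q.
Proof. by have [-> _] := mpoly.mmap_is_multiplicative x (@ratr R). Qed.

Lemma evC (x : 'I_N -> R) c : ev x (mpoly.mpolyC N c) = ratr c.
Proof. exact: mpoly.mmapC. Qed.

Lemma evX (x : 'I_N -> R) i : ev x (mpoly.mpolyX rat (mpoly.mnm1 i)) = x i.
Proof. by rewrite mpoly.mmapX mpoly.mmap1U. Qed.

Lemma ev0 (x : 'I_N -> R) : ev x 0 = 0.
Proof. exact: mpoly.mmap0. Qed.

Lemma polyfun_ev (P : poly_rat) : polyfun (@rational R) (fun x => ev x P)
  (fun x h => \sum_(i < N) ev x (mpoly.mderiv i P) * h i).
Proof.
elim/mpoly_ring_ind: P => [c|i|P Q KP KQ|P Q KP KQ].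
- have rc : rational (ratr c : R) by exists c.
  apply: polyfun_eq (polyfun_cst _ rc) _ _ => [x|x h].
  + by rewrite evC.
  + by rewrite big1 // => i _; rewrite mpoly.mderivC ev0 mul0r.
- apply: polyfun_eq (polyfun_var _ i) _ _ => [x|x h]; first by rewrite evX.
  rewrite (bigD1 i) //= big1 ?addr0 => [|j ji].
    rewrite mpoly.mderivX mpoly.mnm1E eqxx scale1r.
    have -> : (mpoly.mnm_sub (mpoly.mnm1 i) (mpoly.mnm1 i)) = mpoly.mnm0 :> mpoly.multinom N.
      by apply/mpoly.mnmP => k; rewrite mpoly.mnmBE mpoly.mnm0E subnn.
    by rewrite mpoly.mmapX mpoly.mmap11 mul1r.
  by rewrite mpoly.mderivX mpoly.mnm1E eq_sym (negPf ji) scale0r ev0 mul0r.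
- apply: polyfun_eq (polyfun_add KP KQ) _ _ => [x|x h]; first by rewrite evD.
  by rewrite -big_split; apply: eq_bigr => i _; rewrite mpoly.mderivD evD mulrDl.
- apply: polyfun_eq (polyfun_mul KP KQ) _ _ => [x|x h]; first by rewrite evM.
  rewrite mulr_suml mulr_sumr -big_split /=; apply: eq_bigr => i _.
  by rewrite mpoly.mderivM evD !evM; ring.
Qed.

Lemma polyfun_rational_ev (J : finType) (r : J -> 'I_N) f df :
  polyfun (@rational R) f df ->
  exists P : poly_rat, forall x, f (fun j => x (r j)) = ev x P.
Proof.
elim=> [_ [c ->]|j|f1 d1 f2 d2 _ [P EP] _ [Q EQ]|f1 d1 f2 d2 _ [P EP] _ [Q EQ]].
- by exists (mpoly.mpolyC N c) => x; rewrite evC.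
- by exists (mpoly.mpolyX rat (mpoly.mnm1 (r j))) => x; rewrite evX.
- by exists (P + Q) => x; rewrite evD EP EQ.
- by exists (P * Q) => x; rewrite evM EP EQ.
Qed.

(* Induction on the degree: if [P] vanishes everywhere, so do its partial
   derivatives. *)
Lemma ev_eq0 (P : poly_rat) : (forall x, ev x P = 0) -> P = 0.
Proof.
move=> P0.
have [n degP] : exists n, forall m, (n <= mpoly.mdeg m)%N -> mpoly.mcoeff m P = 0.
  exists (mpoly.msize P) => m; rewrite leqNgt => nm.
  apply/eqP; rewrite mpoly.mcoeff_eq0; apply: contra nm; exact: mpoly.msize_mdeg_lt.
elim: n P P0 degP => [|n IH] P P0 degP.
  by apply/mpoly.mpolyP => m; rewrite mpoly.mcoeff0 degP.
have dP0 i : mpoly.mderiv i P = 0.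
  apply: IH => [x|m nm].
    have := polyfun_vanish (polyfun_ev P) P0 x (fun j => (j == i)%:R).
    rewrite (bigD1 i) //= eqxx mulr1 big1 ?addr0 // => j ji.
    by rewrite (negPf ji) mulr0.
  by rewrite mpoly.mcoeff_mderiv degP ?mul0rn // mpoly.mdegD mpoly.mdeg1 addn1 ltnS.
have Pm m : m != mpoly.mnm0 -> mpoly.mcoeff m P = 0.
  move=> mn0; have [i mi] : exists i, m i != 0%N.
    apply: contrapT => nex; case/eqP: mn0; apply/mpoly.mnmP => i.
    by rewrite mpoly.mnm0E; apply/eqP/negPn/negP => h; apply: nex; exists i.
  pose m' := mpoly.mnm_sub m (mpoly.mnm1 i).
  have -> : m = mpoly.mnm_add m' (mpoly.mnm1 i).
    apply/mpoly.mnmP => j; rewrite mpoly.mnmDE mpoly.mnmBE mpoly.mnm1E subnK //.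
    by case: eqP => // <-; rewrite lt0n.
  have := mpoly.mcoeff_mderiv i P m'; rewrite dP0 mpoly.mcoeff0 => /esym/eqP.
  by rewrite mulrn_eq0 /= => /eqP.
have PC : P = mpoly.mpolyC N (mpoly.mcoeff mpoly.mnm0 P).
  apply/mpoly.mpolyP => m; rewrite mpoly.mcoeffC.
  by case: eqVneq => [->|/Pm ->]; rewrite ?mulr1 ?mulr0.
have := P0 (fun=> 0); rewrite PC evC => /eqP; rewrite fmorph_eq0 => /eqP ->.
exact: mpoly.mpolyC0.
Qed.

Lemma countable_mpoly : countable [set: poly_rat]%classic.
Proof.
pose code (P : poly_rat) : seq (mpoly.multinom N * rat) :=
  [seq (m, mpoly.mcoeff m P) | m <- mpoly.msupp P].
apply/countable_injP; exists (fun P => pickle (code P)) => P Q _ _.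
move/(pcan_inj pickleK) => E.
rewrite (mpoly.mpolyE P) (mpoly.mpolyE Q).
have F (S : poly_rat) : \sum_(m <- mpoly.msupp S) (mpoly.mcoeff m S) *: mpoly.mpolyX rat m
  = \sum_(z <- code S) z.2 *: mpoly.mpolyX rat z.1.
  by rewrite /code [RHS]big_map.
by rewrite !F E.
Qed.

(* The coordinates are chosen one at a time; after [k] steps every nonzero
   polynomial still has a non-root whose first [k] coordinates are the chosen
   ones, and each polynomial excludes finitely many values of the next one. *)
Lemma algebraically_independent_near (c : 'I_N -> R) delta : 0 < delta ->
  exists2 x : 'I_N -> R, (forall i, `|x i - c i| <= delta) &
    forall P : poly_rat, P != 0 -> ev x P != 0.
Proof.
move=> d0.
suff H k : (k <= N)%N -> exists2 x : 'I_N -> R, (forall i, `|x i - c i| <= delta) &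
    forall P : poly_rat, P != 0 ->
      exists2 y : 'I_N -> R, (forall i : 'I_N, (i < k)%N -> y i = x i) & ev y P != 0.
  have [x xc xP] := H N (leqnn N); exists x => // P /xP[y yx].
  by have -> : y = x by apply/funext => i; rewrite yx.
elim: k => [_|k IH kN].
  exists c => [i|P Pn0]; first by rewrite subrr normr0 ltW.
  apply: contrapT => nex; case/eqP: Pn0; apply: ev_eq0 => x.
  by apply/eqP/negPn/negP => h; apply: nex; exists x.
have [x xc xP] := IH (ltnW kN); pose k0 := Ordinal kN.
have [Y YP] : {Y : poly_rat -> 'I_N -> R & forall P, P != 0 ->
    (forall i : 'I_N, (i < k)%N -> Y P i = x i) /\ ev (Y P) P != 0}.
  apply: (@choice _ _ (fun P y => P != 0 ->
    (forall i : 'I_N, (i < k)%N -> y i = x i) /\ ev y P != 0)) => P.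
  have [->|/xP[y y1 y2]] := eqVneq P 0; first by exists x.
  by exists y.
pose upd (y : 'I_N -> R) t : 'I_N -> R := fun i => if i == k0 then t else y i.
(* Values of the next coordinate that spoil the chosen non-root [Y P]: they are roots of the
   restriction of [P] to a line, which is a nonzero polynomial because [Y P] lies on that line. *)
pose bad P := [set t | P != 0 /\ ev (upd (Y P) t) P = 0]%classic.
have cbad : countable (\bigcup_(P in [set: poly_rat]) bad P)%classic.
  apply: bigcup_countable => [|P _]; first exact: countable_mpoly.
  have [g [gE _]] := polyfun_line (polyfun_ev P) (Y P) (fun i => (i == k0)%:R).
  have updE t : upd (Y P) t = (fun i => Y P i + (t - Y P k0) * (i == k0)%:R).
    apply/funext => i; rewrite /upd; case: eqP => [->|_].
      by rewrite mulr1 addrC subrK.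
    by rewrite mulr0 addr0.
  have [P0|Pn0] := eqVneq P 0.
    have -> : bad P = set0 by rewrite -subset0 => t [] /=; rewrite P0 eqxx.
    exact: countable0.
  have gn0 : g != 0.
    have [_] := YP _ Pn0; apply: contraNneq => g0; rewrite g0 in gE.
    have E : (fun i => Y P i + 0 * (i == k0)%:R) = Y P.
      by apply/funext => i; rewrite mul0r addr0.
    by move: (gE 0); rewrite E horner0 => ->.
  have [s sP] := roots_seq gn0.
  apply: (@sub_countable _ _ _ [set` [seq t + Y P k0 | t <- s]]%classic).
    apply: subset_card_le => t [_ tE] /=; apply/mapP; exists (t - Y P k0); last by rewrite subrK.
    by apply: sP; rewrite /root -gE -updE tE.
  by apply: finite_set_countable; exact: finite_seq.
have ltc : c k0 - delta < c k0 + delta by lra.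
have [t tc tbad] := interval_avoid_countable cbad ltc.
exists (upd x t) => [i|P Pn0].
  rewrite /upd; case: eqP => [->|_] //.
  by rewrite ler_distl; case/andP: tc => -> ->.
have [Y1 Y2] := YP _ Pn0; exists (upd (Y P) t).
  move=> i; rewrite ltnS leq_eqVlt /upd => /orP[/eqP ik|ik].
    by have -> : i = k0; [apply: val_inj | rewrite eqxx].
  by rewrite Y1.
by apply/eqP => E; apply: tbad; exists P.
Qed.

End MultivariatePolynomials.

(** * Generic realisations *)

Section DotProduct.
Variables (R : realType) (d : nat).
Implicit Types u v w : 'rV[R]_d.

Definition dot u v : R := \sum_(l < d) u 0 l * v 0 l.

Lemma dotC u v : dot u v = dot v u.
Proof. by apply: eq_bigr => l _; rewrite mulrC. Qed.

Lemma dotDl u v w : dot (u + v) w = dot u w + dot v w.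
Proof. by rewrite -big_split; apply: eq_bigr => l _; rewrite mxE mulrDl. Qed.

Lemma dotZl c u v : dot (c *: u) v = c * dot u v.
Proof. by rewrite mulr_sumr; apply: eq_bigr => l _; rewrite mxE mulrA. Qed.

Lemma dot0l u : dot 0 u = 0.
Proof. by rewrite -(scale0r 0) dotZl mul0r. Qed.

Lemma dotNl u v : dot (- u) v = - dot u v.
Proof. by rewrite -scaleN1r dotZl mulN1r. Qed.

Lemma dotDr u v w : dot w (u + v) = dot w u + dot w v.
Proof. by rewrite dotC dotDl !(dotC w). Qed.

Lemma dotZr c u v : dot u (c *: v) = c * dot u v.
Proof. by rewrite dotC dotZl dotC. Qed.

Lemma dotNr u v : dot u (- v) = - dot u v.
Proof. by rewrite dotC dotNl dotC. Qed.

Lemma dotBr u v w : dot w (u - v) = dot w u - dot w v.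
Proof. by rewrite dotDr dotNr. Qed.

Lemma dot_suml (I : Type) (s : seq I) (P : pred I) (F : I -> 'rV[R]_d) v :
  dot (\sum_(i <- s | P i) F i) v = \sum_(i <- s | P i) dot (F i) v.
Proof.
by elim/big_rec2: _ => [|i y1 y2 _ <-]; [exact: dot0l | rewrite dotDl].
Qed.

Lemma dot_ge0 u : 0 <= dot u u.
Proof. by apply: sumr_ge0 => l _; rewrite -expr2 sqr_ge0. Qed.

Lemma dot_eq0 u : dot u u = 0 -> u = 0.
Proof.
move=> /eqP; rewrite psumr_eq0 => [/allP u0|l _]; last by rewrite -expr2 sqr_ge0.
apply/rowP => l; rewrite mxE; apply/eqP.
by have := u0 l (mem_index_enum _); rewrite mulf_eq0 orbb.
Qed.

Lemma sqdistE u v : sqdist u v = dot (u - v) (u - v).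
Proof. by apply: eq_bigr => l _; rewrite !mxE expr2. Qed.

Lemma sqdistC u v : sqdist u v = sqdist v u.
Proof. by rewrite !sqdistE -(opprB u) dotNl dotNr opprK. Qed.

Lemma derivation_sqdist (D : R -> R) u v : derivation D ->
  D (sqdist u v) = 2 * dot (u - v) (map_mx D u - map_mx D v).
Proof.
move=> Dd; have [DD DM] := Dd.
rewrite /sqdist (big_morph D DD (derivation0 Dd)) mulr_sumr; apply: eq_bigr => l _.
by rewrite expr2 DM !(derivationB _ _ Dd) !mxE; ring.
Qed.

End DotProduct.

Section GenericRealisations.
Variables (R : realType) (d : nat) (V : finType).
Implicit Types p q : realisation R d V.

Definition flat p : V * 'I_d -> R := fun j => p j.1 0 j.2.
Definition unflat (x : V * 'I_d -> R) : realisation R d V := fun v => \row_l x (v, l).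

Lemma unflatK x : flat (unflat x) = x.
Proof. by apply/funext => -[v l]; rewrite /flat /unflat mxE. Qed.

Definition coord_index (j : V * 'I_d) : 'I_(#|V| * d) :=
  mxvec_index (enum_rank j.1) j.2.

Lemma coords_flat p : (fun j => coords p (coord_index j)) = flat p.
Proof.
by apply/funext => j; rewrite /coords /coord_index mxvecE mxE enum_rankK.
Qed.

Lemma generic_polyfun_eq0 p f df : generic p -> polyfun (@rational R) f df ->
  f (flat p) = 0 -> forall x, f x = 0.
Proof.
move=> gp /(polyfun_rational_ev coord_index) [P PE].
rewrite -coords_flat PE => p0 x.
have P0 : P = 0 by apply/eqP/negPn/negP => /gp; rewrite p0 eqxx.
by rewrite -(unflatK x) -coords_flat PE P0 ev0.
Qed.

(** On rational polynomials in the coordinates of [p], differentiation along [v] is well defined,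
    because a polynomial that vanishes at [p] vanishes identically; this partial derivation extends
    to the reals. *)
Lemma generic_derivation p (v : V * 'I_d -> R) : generic p ->
  exists2 D, derivation D & forall j, D (flat p j) = v j.
Proof.
move=> gp.
pose S a a' := exists f df,
  [/\ polyfun (@rational R) f df, a = f (flat p) & a' = df (flat p) v].
have Sder : partial_derivation S.
  split.
  - exists (fun=> 1), (fun _ _ => 0); split=> //.
    exact: polyfun_cst (rational_nat _ 1).
  - move=> _ _ _ _ [f [df [pf -> ->]]] [g [dg [pg -> ->]]].
    exists (fun x => f x - g x), (fun x h => df x h - dg x h); split=> //.
    exact: polyfun_sub.
  - move=> _ _ _ _ [f [df [pf -> ->]]] [g [dg [pg -> ->]]].
    exists (fun x => f x * g x), (fun x h => df x h * g x + f x * dg x h); split=> //.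
    exact: polyfun_mul.
  - move=> a' [f [df [pf /esym f0 ->]]].
    by apply: polyfun_vanish pf (generic_polyfun_eq0 gp pf f0) _ _.
have [D [Dd DS]] := partial_derivation_extends Sder.
exists D => // j; apply: DS; exists (fun x => x j), (fun _ h => h j); split=> //.
exact: polyfun_var.
Qed.

Lemma generic_near (c : realisation R d V) delta : 0 < delta ->
  exists2 p, generic p & forall v l, `|p v 0 l - c v 0 l| <= delta.
Proof.
move=> d0.
have [x xc xP] := @algebraically_independent_near R _ (coords c) delta d0.
pose p : realisation R d V := fun v => \row_l x (coord_index (v, l)).
have pE : coords p = x.
  apply/funext => k; rewrite /coords; case/mxvec_indexP: k => i l.
  by rewrite mxvecE !mxE /coord_index /= enum_valK.
exists p => [P /xP|v l]; first by rewrite pE.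
have E q := congr1 (@^~ (v, l)) (coords_flat q); rewrite /flat /= in E.
by have := xc (coord_index (v, l)); rewrite -pE !E.
Qed.

End GenericRealisations.

(** * Stresses and the rigidity map *)

Section Stresses.
Variables (R : realType) (d : nat) (V : finType).
Implicit Types (p q w : realisation R d V) (H : rel V).

(** Linear independence of the rows of the rigidity matrix, with stresses taken as symmetric
    functions on ordered pairs. *)
Definition stress_free H q : Prop := forall omega : V -> V -> R,
  (forall a b, omega a b = omega b a) ->
  (forall a b, ~~ H a b -> omega a b = 0) ->
  (forall a, \sum_b omega a b *: (q a - q b) = 0) ->
  forall a b, omega a b = 0.

(** Half the derivative of the squared length of [a b] along the velocity [w]. *)
Definition edge_derivative q w (a b : V) : R := dot (q a - q b) (w a - w b).

Definition rigidity_map_onto H q : Prop := forall mu : V -> V -> R,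
  (forall a b, mu a b = mu b a) ->
  exists w, forall a b, H a b -> edge_derivative q w a b = mu a b.

Lemma edge_derivativeC q w a b : edge_derivative q w a b = edge_derivative q w b a.
Proof.
by rewrite /edge_derivative -(opprB (q b)) -(opprB (w b)) dotNl dotNr opprK.
Qed.

(** Virtual work: the forces at each vertex cancel, so they do no work against its velocity, and
    each edge collects the work at its two ends. *)
Lemma equilibrium_work (omega : V -> V -> R) q w :
  (forall a b, omega a b = omega b a) ->
  (forall a, \sum_b omega a b *: (q a - q b) = 0) ->
  \sum_a \sum_b omega a b * edge_derivative q w a b = 0.
Proof.
move=> osym oeq.
have E0 : \sum_a \sum_b omega a b * dot (q a - q b) (w a) = 0.
  apply: big1 => a _; rewrite -[RHS](dot0l (w a)) -(oeq a) dot_suml.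
  by apply: eq_bigr => b _; rewrite dotZl.
have E1 : \sum_a \sum_b omega a b * dot (q a - q b) (w b) = 0.
  rewrite exchange_big /=; apply: big1 => b _.
  transitivity (- dot (\sum_a omega b a *: (q b - q a)) (w b)); last by rewrite oeq dot0l oppr0.
  rewrite dot_suml -sumrN; apply: eq_bigr => a _.
  by rewrite dotZl -(opprB (q a)) dotNl mulrN opprK osym.
transitivity (\sum_a \sum_b omega a b * dot (q a - q b) (w a)
   - \sum_a \sum_b omega a b * dot (q a - q b) (w b)); last by rewrite E0 E1 subr0.
rewrite -sumrB; apply: eq_bigr => a _; rewrite -sumrB; apply: eq_bigr => b _.
by rewrite /edge_derivative dotBr mulrBr.
Qed.

(** A velocity whose edge derivatives equal the stress turns the virtual work into a sum of
    squares. *)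
Lemma rigidity_map_onto_stress_free H q : rigidity_map_onto H q -> stress_free H q.
Proof.
move=> onto omega osym osupp oeq a b.
have [w wE] := onto omega osym.
have := equilibrium_work w osym oeq; rewrite pair_big /= => W0.
have : \sum_(e : V * V) omega e.1 e.2 ^+ 2 = 0.
  rewrite -[RHS]W0; apply: eq_bigr => -[c e] _ /=.
  have [Hce|/osupp ->] := boolP (H c e); first by rewrite wE // expr2.
  by rewrite mul0r expr0n.
move/eqP; rewrite psumr_eq0 => [/allP o0|e _]; last exact: sqr_ge0.
by have := o0 (a, b) (mem_index_enum _); rewrite /= sqrf_eq0 => /eqP.
Qed.

(** Tested against a velocity that, among the edges, changes only the length of [a b], the virtual
    work isolates the stress on that edge. *)
Lemma separated_edges_stress_free H q : irreflexive H ->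
  (forall a b, H a b -> exists w, edge_derivative q w a b != 0 /\
     forall c e, del_edge H a b c e -> edge_derivative q w c e = 0) ->
  stress_free H q.
Proof.
move=> Hirr sep omega osym osupp oeq a b.
have [Hab|/osupp //] := boolP (H a b).
have [w [wab w0]] := sep a b Hab.
have ab : (b == a) = false.
  by apply/eqP => E; rewrite E Hirr in Hab.
have := equilibrium_work w osym oeq; rewrite pair_big /=.
rewrite (bigD1 (a, b)) //= (bigD1 (b, a)) /=; last first.
  by rewrite xpair_eqE ab.
rewrite big1 ?addr0 => [|[c e] /= /andP[]]; last first.
  rewrite !xpair_eqE => h1 h2.
  have [Hce|/osupp ->] := boolP (H c e); last by rewrite mul0r.
  by rewrite w0 ?mulr0 // /del_edge Hce negb_or h1 h2.
rewrite -osym -(edge_derivativeC q w a b) -mulrDl => /eqP.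
rewrite mulf_eq0 (negPf wab) orbF -mulr2n mulrn_eq0 /= => /eqP //.
Qed.

End Stresses.

(** * The Gram matrix of the rows of the rigidity matrix *)

Section GramMatrix.
Variables (R : realType) (d : nat) (V : finType) (H : rel V).
Hypotheses (Hsym : symmetric H) (Hirr : irreflexive H).

(** One orientation per edge, so that each length equation occurs once and the equations can be
    independent. *)
Definition oriented_edge : Type :=
  {e : V * V | H e.1 e.2 && (enum_rank e.1 < enum_rank e.2)%N}.
HB.instance Definition _ := Finite.on oriented_edge.

Lemma oriented_edgeP a b : H a b ->
  (exists e : oriented_edge, val e = (a, b)) \/ (exists e : oriented_edge, val e = (b, a)).
Proof.
move=> Hab; have [lt|lt|/val_inj/enum_rank_inj E] := ltngtP (enum_rank a) (enum_rank b).
- have eP : H (a, b).1 (a, b).2 && (enum_rank (a, b).1 < enum_rank (a, b).2)%N by rewrite /= Hab.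
  by left; exists (Sub (a, b) eP).
- have eP : H (b, a).1 (b, a).2 && (enum_rank (b, a).1 < enum_rank (b, a).2)%N by rewrite /= Hsym Hab.
  by right; exists (Sub (b, a) eP).
- by rewrite E Hirr in Hab.
Qed.

Lemma oriented_extension (T : oriented_edge -> R) :
  exists2 mu : V -> V -> R, (forall a b, mu a b = mu b a) &
    forall e, mu (val e).1 (val e).2 = T e.
Proof.
exists (fun a b => \sum_e T e * ((val e == (a, b))%:R + (val e == (b, a))%:R)).
  by move=> a b; apply: eq_bigr => e _; rewrite addrC.
move=> e; have /andP[_ lte] := valP e.
rewrite (bigD1 e) //= big1 ?addr0 => [|k ke].
  rewrite -surjective_pairing eqxx; case: eqP => [E|_]; last by rewrite addr0 mulr1.
  by have /= E1 := congr1 fst E; rewrite E1 ltnn in lte.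
rewrite -surjective_pairing -[val k == val e]/(k == e) (negPf ke).
case: eqP => [E|_]; last by rewrite addr0 mulr0.
have /andP[_] := valP k; rewrite /= E /= => ltk.
by have := ltn_trans lte ltk; rewrite ltnn.
Qed.

Definition rigidity_entry (x : V * 'I_d -> R) (e : V * V) (j : V * 'I_d) : R :=
  ((j.1 == e.1)%:R - (j.1 == e.2)%:R) * (x (e.1, j.2) - x (e.2, j.2)).

(** The rigidity matrix times its transpose: its determinant is a single rational polynomial in the
    coordinates that decides whether the rows are independent. *)
Definition rigidity_gram (x : V * 'I_d -> R) : 'M[R]_#|{: oriented_edge}| :=
  \matrix_(i, k) \sum_j rigidity_entry x (val (enum_val i)) j *
                        rigidity_entry x (val (enum_val k)) j.

Lemma sum_rigidity_entry x (e : V * V) (y : V * 'I_d -> R) :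
  \sum_j rigidity_entry x e j * y j =
  \sum_l (x (e.1, l) - x (e.2, l)) * (y (e.1, l) - y (e.2, l)).
Proof.
transitivity (\sum_v \sum_l rigidity_entry x e (v, l) * y (v, l)).
  by rewrite pair_bigA; apply: eq_bigr => -[].
rewrite exchange_big /=; apply: eq_bigr => l _; rewrite /rigidity_entry /=.
have F (a : V) : \sum_v (v == a)%:R * y (v, l) = y (a, l).
  rewrite (bigD1 a) //= eqxx mul1r big1 ?addr0 // => v /negPf ->.
  by rewrite mul0r.
rewrite mulrBr -{1}(F e.1) -{1}(F e.2) !mulr_sumr -sumrB.
by apply: eq_bigr => v _; ring.
Qed.

Lemma rigidity_gram_polyfun :
  exists df, polyfun (@rational R) (fun x => \det (rigidity_gram x)) df.
Proof.
have entry e j : exists df, polyfun (@rational R) (fun x => rigidity_entry x e j) df.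
  eexists; apply: polyfun_mul.
    apply: polyfun_sub; apply: (polyfun_cst _ (rational_nat _ _)).
  by apply: polyfun_sub; apply: polyfun_var.
have gram i k : exists df, polyfun (@rational R) (fun x => rigidity_gram x i k) df.
  have term j : {df | polyfun (@rational R) (fun x : V * 'I_d -> R =>
      rigidity_entry x (val (enum_val i)) j * rigidity_entry x (val (enum_val k)) j) df}.
    have [d1 p1] := cid (entry (val (enum_val i)) j).
    have [d2 p2] := cid (entry (val (enum_val k)) j).
    by eexists; exact: polyfun_mul p1 p2.
  eexists; apply: polyfun_eq (polyfun_sum _ (fun j => projT2 (term j))) _ _ => // x.
  by rewrite mxE.
have term (s : 'S_#|{: oriented_edge}|) : {df | polyfun (@rational R)
    (fun x => (-1) ^+ s * \prod_i rigidity_gram x i (s i)) df}.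
  have [d2 p2] := cid (polyfun_prod (index_enum _) (fun i => gram i (s i))).
  have r : rational ((-1) ^+ s : R) by exists ((-1) ^+ s); rewrite rmorph_sign.
  by eexists; exact: polyfun_mul (polyfun_cst _ r) p2.
by eexists; exact: polyfun_sum _ (fun s => projT2 (term s)).
Qed.

(** For a kernel vector [u] of the Gram matrix, the combination of rows with coefficients [u] has
    squared norm zero. Its vanishing says that [u], symmetrised, is an equilibrium stress. *)
Lemma stress_free_gram_neq0 (q : realisation R d V) :
  stress_free H q -> \det (rigidity_gram (flat q)) != 0.
Proof.
move=> sf; apply/eqP => /eqP/det0P[u un0 uG].
pose S j := \sum_i u 0 i * rigidity_entry (flat q) (val (enum_val i)) j.
have S0 j : S j = 0.
  have : \sum_j S j ^+ 2 = 0.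
    transitivity ((u *m rigidity_gram (flat q) *m u^T) 0 0); last by rewrite uG mul0mx mxE.
    rewrite !mxE; under [RHS]eq_bigr => k _ do rewrite !mxE mulr_suml.
    rewrite exchange_big /=.
    under [RHS]eq_bigr => i _ do under eq_bigr => k _ do rewrite mxE mulr_sumr mulr_suml.
    rewrite exchange_big /=; under [RHS]eq_bigr => i _ do rewrite exchange_big /=.
    rewrite exchange_big /=; apply: eq_bigr => j0 _.
    rewrite expr2 /S big_distrlr /= exchange_big; apply: eq_bigr => i _; apply: eq_bigr => k _ /=.
    ring.
  move/eqP; rewrite psumr_eq0 => [/allP s0|j' _]; last exact: sqr_ge0.
  by have := s0 j (mem_index_enum _); rewrite sqrf_eq0 => /eqP.
pose en (i : 'I_#|{: oriented_edge}|) : V * V := val (enum_val i).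
pose omega a b := \sum_i u 0 i * ((en i == (a, b))%:R + (en i == (b, a))%:R).
have osym a b : omega a b = omega b a.
  by apply: eq_bigr => i _; rewrite addrC.
have enH i : H (en i).1 (en i).2 by have /andP[] := valP (enum_val i).
have enlt i : (enum_rank (en i).1 < enum_rank (en i).2)%N by have /andP[] := valP (enum_val i).
have osupp a b : ~~ H a b -> omega a b = 0.
  move=> nH; apply: big1 => i _.
  have -> : (en i == (a, b)) = false by apply: contraNF nH => /eqP E; have := enH i; rewrite E.
  have -> : (en i == (b, a)) = false by apply: contraNF nH => /eqP E; have := enH i; rewrite E Hsym.
  by rewrite addr0 mulr0.
have oeq a : \sum_b omega a b *: (q a - q b) = 0.
  apply/rowP => l; rewrite summxE !mxE -[RHS](S0 (a, l)).
  transitivity (\sum_b \sum_i u 0 i * ((en i == (a, b))%:R + (en i == (b, a))%:R) * (q a 0 l - q b 0 l)).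
    by apply: eq_bigr => b _; rewrite !mxE mulr_suml.
  rewrite exchange_big; apply: eq_bigr => i _ /=.
  under eq_bigr => b _ do rewrite -mulrA.
  rewrite -mulr_sumr; congr (_ * _); rewrite /rigidity_entry /= -/(en i).
  case: (en i) => c e /=.
  under eq_bigr => b _ do rewrite !xpair_eqE mulrDl.
  rewrite big_split /= (bigD1 e) //= big1 ?addr0; last first.
    by move=> b be; rewrite [e == b]eq_sym (negPf be) andbF mul0r.
  rewrite (bigD1 c) //= big1 ?addr0; last first.
    by move=> b be; rewrite [c == b]eq_sym (negPf be) mul0r.
  rewrite !eqxx andbT /= /flat /= [a == c]eq_sym [a == e]eq_sym.
  by case: eqP => [->|_]; case: eqP => [->|_]; rewrite /=; ring.
have o0 := sf omega osym osupp oeq.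
case/eqP: un0; apply/rowP => i; rewrite mxE -(o0 (en i).1 (en i).2) /omega.
rewrite (bigD1 i) //= big1 ?addr0.
  rewrite -surjective_pairing eqxx; case: eqP => [E|_]; last by rewrite addr0 mulr1.
  by have := enlt i; have /= -> := congr1 fst E; rewrite ltnn.
move=> k ki; rewrite -surjective_pairing.
have -> : (en k == en i) = false.
  by apply: contraNF ki => /eqP/val_inj/enum_val_inj ->.
have -> : (en k == ((en i).2, (en i).1)) = false.
  apply/eqP => E; have := enlt k; rewrite E /= ltnNge => /negP[]; apply: ltnW; exact: enlt.
by rewrite addr0 mulr0.
Qed.

Lemma gram_neq0_onto (q : realisation R d V) :
  \det (rigidity_gram (flat q)) != 0 -> rigidity_map_onto H q.
Proof.
move=> Gn0 mu musym.
have Gu : rigidity_gram (flat q) \in unitmx by rewrite unitmxE unitfE.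
pose m : 'rV[R]_#|{: oriented_edge}| := \row_i mu (val (enum_val i)).1 (val (enum_val i)).2.
have [u uG] : exists u, u *m rigidity_gram (flat q) = m.
  by exists (m *m invmx (rigidity_gram (flat q))); rewrite mulmxKV.
pose y j := \sum_i u 0 i * rigidity_entry (flat q) (val (enum_val i)) j.
have yE (e : oriented_edge) : edge_derivative q (unflat y) (val e).1 (val e).2 = mu (val e).1 (val e).2.
  transitivity (m 0 (enum_rank e)); last by rewrite mxE enum_rankK.
  rewrite -uG mxE.
  transitivity (\sum_j rigidity_entry (flat q) (val e) j * y j).
    rewrite sum_rigidity_entry; apply: eq_bigr => l _.
    by rewrite /unflat !mxE.
  under eq_bigr => j _ do rewrite mulr_sumr.
  rewrite exchange_big; apply: eq_bigr => i _; rewrite mxE enum_rankK mulr_sumr.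
  by apply: eq_bigr => j _ /=; ring.
exists (unflat y) => a b /oriented_edgeP[[e E]|[e E]]; have := yE e; rewrite E //=.
by rewrite musym edge_derivativeC.
Qed.

Lemma stress_free_onto (q : realisation R d V) : stress_free H q -> rigidity_map_onto H q.
Proof. by move/stress_free_gram_neq0/gram_neq0_onto. Qed.

(** The Gram determinant is nonzero at [q], hence a nonzero polynomial, hence nonzero at [p]. *)
Lemma stress_free_generic (p q : realisation R d V) :
  generic p -> stress_free H q -> stress_free H p.
Proof.
move=> gp /stress_free_gram_neq0 qn0; apply: rigidity_map_onto_stress_free.
apply: gram_neq0_onto; have [df pf] := rigidity_gram_polyfun.
by apply: contra_neq qn0 => p0; exact: (generic_polyfun_eq0 gp pf p0).
Qed.

End GramMatrix.

(** * Motions *)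

Section Motions.
Variables (R : realType) (d : nat) (V : finType).
Implicit Types (p q w : realisation R d V) (H G : rel V).

Lemma polyfun_sqdist (a b : V) : polyfun (@rational R)
  (fun x : V * 'I_d -> R => \sum_l (x (a, l) - x (b, l)) ^+ 2)
  (fun x h => \sum_l 2 * ((x (a, l) - x (b, l)) * (h (a, l) - h (b, l)))).
Proof.
apply: polyfun_sum => l; apply: polyfun_sqr.
by apply: polyfun_sub; apply: polyfun_var.
Qed.

(** [D] sends the coordinates of [p] to those of a velocity realising [mu]. Applied to the equality
    of squared lengths in [p] and [q], it equates the edge derivatives of the two. *)
Lemma generic_equivalent_derivation H p q (mu : V -> V -> R) :
  generic p -> rigidity_map_onto H p -> equivalent H p q ->
  (forall a b, mu a b = mu b a) ->
  exists2 D, derivation D &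
    forall a b, H a b -> edge_derivative q (fun v => map_mx D (q v)) a b = mu a b.
Proof.
move=> gp onto pq musym; have [w wE] := onto mu musym.
have [D Dd DE] := generic_derivation (flat w) gp.
exists D => // a b Hab; rewrite -wE //.
have Dp v : map_mx D (p v) = w v.
  by apply/rowP => l; rewrite mxE; exact: (DE (v, l)).
have := congr1 D (pq a b Hab); rewrite !derivation_sqdist // !Dp.
by rewrite /edge_derivative => E; lra.
Qed.

Lemma equivalent_onto H p q : generic p -> rigidity_map_onto H p ->
  equivalent H p q -> rigidity_map_onto H q.
Proof.
move=> gp onto pq mu musym.
have [D _ DE] := generic_equivalent_derivation gp onto pq musym.
by exists (fun v => map_mx D (q v)).
Qed.

(* [F] is the ring of rational polynomials in [p] that are constant on the
   fibre of [p].  Either the squared length of [ab] is algebraic over [F], hence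
   takes finitely many values on the fibre, or it is transcendental and some
   derivation kills [F] but not this squared length. *)
Lemma edge_dichotomy H p a b : generic p ->
  (exists w, edge_derivative p w a b != 0 /\
     forall c e, H c e -> edge_derivative p w c e = 0) \/
  (exists2 g : {poly R}, g != 0 &
     forall q, equivalent H p q -> g.[sqdist (q a) (q b)] = 0).
Proof.
move=> gp; set lam := sqdist (p a) (p b).
pose F z := exists f df, [/\ polyfun (@rational R) f df, f (flat p) = z &
   forall q, equivalent H p q -> f (flat q) = z].
pose SF (z z' : R) := F z /\ z' = 0.
have SFd : partial_derivation SF.
  split.
  - split=> //; exists (fun=> 1), (fun _ _ => 0); split=> //.
    exact: polyfun_cst (rational_nat _ 1).
  - move=> _ _ _ _ [[f [df [pf <- fE]]] ->] [[g [dg [pg <- gE]]] ->]; split; last by rewrite subr0.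
    exists (fun x => f x - g x), (fun x h => df x h - dg x h); split=> // [|q pq].
      exact: polyfun_sub.
    by rewrite fE // gE.
  - move=> _ _ _ _ [[f [df [pf <- fE]]] ->] [[g [dg [pg <- gE]]] ->].
    split; last by rewrite mul0r mulr0 addr0.
    exists (fun x => f x * g x), (fun x h => df x h * g x + f x * dg x h); split=> // [|q pq].
      exact: polyfun_mul.
    by rewrite fE // gE.
  - by move=> z' [].
have [[g [gF gn0 glam]]|ntr] :=
    pselect (exists g : {poly R}, [/\ forall i, F g`_i, g != 0 & g.[lam] = 0]).
  right; exists g => // q pq.
  have gF' : forall i, exists f, exists df, [/\ polyfun (@rational R) f df,
      f (flat p) = g`_i & forall q, equivalent H p q -> f (flat q) = g`_i] := gF.
  have [f fP] := choice gF'.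
  have [df dfP] := choice fP.
  pose L (x : V * 'I_d -> R) := \sum_l (x (a, l) - x (b, l)) ^+ 2.
  have Lpow k : {dL | polyfun (@rational R) (fun x => L x ^+ k) dL}.
    elim: k => [|k [dL pL]]; first by eexists; exact: polyfun_cst (rational_nat _ 1).
    exists (fun x h => (\sum_l 2 * ((x (a, l) - x (b, l)) * (h (a, l) - h (b, l)))) * L x ^+ k + L x * dL x h).
    by apply: polyfun_eq (polyfun_mul (polyfun_sqdist a b) pL) _ _ => // x; rewrite exprS.
  have term (i : 'I_(size g)) : polyfun (@rational R) (fun x => f i x * L x ^+ i)
      (fun x h => df i x h * L x ^+ i + f i x * projT1 (Lpow i) x h).
    by apply: polyfun_mul (projT2 (Lpow i)); case: (dfP i).
  (* With its coefficients written as polynomials in the coordinates, the relation [g.[lam] = 0]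
     holds at the generic [p], hence identically; at [q] these coefficients take the same values. *)
  have P := polyfun_sum (index_enum 'I_(size g)) term.
  have P0 := generic_polyfun_eq0 gp P.
  have -> : sqdist (q a) (q b) = L (flat q) by [].
  rewrite horner_coef; transitivity (\sum_(i < size g) f i (flat q) * L (flat q) ^+ i).
    by apply: eq_bigr => i _; have [_ _ ->] := dfP i.
  apply: P0; apply: etrans glam; rewrite horner_coef; apply: eq_bigr => i _.
  by have [_ -> _] := dfP i.
left.
have tr g h : coef_rel SF g h -> g.[lam] = 0 -> g = 0.
  move=> Sgh g0; apply/eqP/negPn/negP => gn0; apply: ntr; exists g; split=> // i.
  by have [] := Sgh i.
(* [lam] receives slope 1 while all of [F], in particular the squared lengths of the edges of [H],
   has derivative 0. *)
have Sd := adjoin_der_partial SFd (transcendental_slope SFd 1 tr).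
have [D [Dd DS]] := partial_derivation_extends Sd.
exists (fun v => map_mx D (p v)); split.
  have := derivation_sqdist (p a) (p b) Dd.
  rewrite -/lam (DS _ _ (adjoin_der_gen SFd lam 1)) => E.
  by apply/eqP; rewrite /edge_derivative => E'; move: E; rewrite E'; lra.
move=> c e Hce.
have := derivation_sqdist (p c) (p e) Dd.
have Fce : SF (sqdist (p c) (p e)) 0.
  split=> //; exists (fun x => \sum_l (x (c, l) - x (e, l)) ^+ 2); eexists.
  split; [exact: polyfun_sqdist|by []|by move=> q pq; exact/esym/pq].
rewrite (DS _ _ (adjoin_der_sub SFd lam 1 Fce)) /edge_derivative; lra.
Qed.

(** Otherwise the intermediate value theorem would give [h] every value between [h 0] and [h t],
    while a nonzero polynomial has finitely many roots. *)
Lemma continuous_roots_constant (h : R -> R) (g : {poly R}) (t : R) :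
  g != 0 -> {within `[0, 1]%classic, continuous h}%classic ->
  (forall s, s \in `[0, 1] -> g.[h s] = 0) -> t \in `[0, 1] -> h t = h 0.
Proof.
move=> gn0 hcont hroot t01; have [s sP] := roots_seq gn0.
have /andP[t0 t1] : 0 <= t <= 1 by rewrite in_itv /= in t01.
apply/eqP/negPn/negP => hne.
have mM : Num.min (h 0) (h t) < Num.max (h 0) (h t).
  by have [lt|lt|E] := ltgtP (h 0) (h t); rewrite ?E ?eqxx // in hne *.
have [v vm nv] := interval_avoid_countable (finite_set_countable (finite_seq s)) mM.
have hc : {within `[0, t]%classic, continuous h}%classic.
  apply: continuous_subspaceW hcont => z; rewrite /= !in_itv /= => /andP[-> zt] /=.
  exact: le_trans t1.
have [c c0t hcv] := IVT t0 hc vm.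
apply: nv; rewrite -hcv; apply: sP; rewrite /root hroot //.
by move: c0t; rewrite !in_itv /= => /andP[-> ct]; exact: le_trans t1.
Qed.

Lemma sqdist_motion_continuous (A : set R) (f : R -> realisation R d V) (a b : V) :
  (forall v (i : 'I_d), {within A, continuous (fun t => f t v 0 i)}%classic) ->
  {within A, continuous (fun t => sqdist (f t a) (f t b))}%classic.
Proof.
move=> fc; apply: continuous_big => [|l _]; first exact: add_continuous.
under eq_fun do rewrite expr2.
by move=> t; apply: cvgM; apply: cvgB; apply: fc.
Qed.

(** In the algebraic case of [edge_dichotomy] the length of [a b] is constant along every motion
    preserving the other edges, so [p] would stay rigid without [a b]. *)
Lemma edge_separated G p a b : generic p -> rigid_fw G p -> G a b ->
  ~ d_rigid R d (del_edge G a b) ->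
  exists w, edge_derivative p w a b != 0 /\
     forall c e, del_edge G a b c e -> edge_derivative p w c e = 0.
Proof.
move=> gp rig Gab nrig.
have [//|[g gn0 gP]] := edge_dichotomy (del_edge G a b) a b gp.
case: nrig; exists p; split=> // f fc f0 feq; apply: rig => // t t01 c e Gce.
have [dce|] := boolP (del_edge G a b c e); first exact: feq.
have lenE : sqdist (p a) (p b) = sqdist (f t a) (f t b).
  rewrite -{1 2}f0; apply/esym.
  apply: (continuous_roots_constant (h := fun t => sqdist (f t a) (f t b)) gn0) => // [|s s01].
    exact: sqdist_motion_continuous.
  exact/gP/feq.
rewrite /del_edge Gce /= negbK => /orP[] /andP[/eqP -> /eqP ->] //.
by rewrite sqdistC lenE sqdistC.
Qed.

Definition add_edge G (a b : V) : rel V :=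
  fun c e => [|| G c e, (c == a) && (e == b) | (c == b) && (e == a)].

Lemma add_edge_sym G a b : symmetric G -> symmetric (add_edge G a b).
Proof.
move=> Gsym c e; rewrite /add_edge Gsym; congr (_ || _).
by rewrite orbC andbC [in X in _ || X]andbC.
Qed.

Lemma add_edge_irr G a b : irreflexive G -> a != b -> irreflexive (add_edge G a b).
Proof.
move=> Girr ab c; rewrite /add_edge Girr /=; apply/negbTE/negP.
by case/orP => /andP[/eqP -> /eqP E]; rewrite E eqxx in ab.
Qed.

(** Clamping time keeps the prescribed lengths within reach of the local inverse, so that a motion
    is defined and continuous on the whole line. *)
Definition clamp (t : R) : R := Num.max 0 (Num.min t 1).

Lemma clamp01 t : 0 <= clamp t <= 1.
Proof. by rewrite /clamp le_max lexx ge_max ler01 ge_min lexx orbT. Qed.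

Lemma clamp_id t : 0 <= t <= 1 -> clamp t = t.
Proof. by move=> /andP[t0 t1]; rewrite /clamp (min_idPl t1) (max_idPr t0). Qed.

Lemma clamp_lipschitz t u : `|clamp t - clamp u| <= `|t - u|.
Proof.
have d1 : t - u <= `|t - u| := ler_norm _.
have d2 : u - t <= `|t - u| by rewrite distrC ler_norm.
move: `|t - u| d1 d2 => m d1 d2.
rewrite /clamp ler_norml; case: (leP t 1) => ?; case: (leP u 1) => ?;
  rewrite ?(max_idPr (@ler01 R)); case: (leP 0 t) => ?; case: (leP 0 u) => ?;
  apply/andP; split; lra.
Qed.

(** The local right inverse lifts a path of edge lengths in which only [a b] grows; the resulting
    motion preserves the lengths of [G] without being a congruence. *)
Lemma flexible_of_independent_edge G p a b : symmetric G -> irreflexive G ->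
  a != b -> ~~ G a b -> rigidity_map_onto (add_edge G a b) p -> ~ rigid_fw G p.
Proof.
move=> Gsym Girr ab nGab onto rig.
have Hsym := add_edge_sym a b Gsym; have Hirr := add_edge_irr Girr ab.
pose H := add_edge G a b.
pose F (e : oriented_edge H) (x : V * 'I_d -> R) :=
  \sum_l (x ((val e).1, l) - x ((val e).2, l)) ^+ 2.
pose dF (e : oriented_edge H) (x h : V * 'I_d -> R) := \sum_l 2 *
  ((x ((val e).1, l) - x ((val e).2, l)) * (h ((val e).1, l) - h ((val e).2, l))).
have pF e : polyfun (@any R) (F e) (dF e).
  exact: polyfun_any (polyfun_sqdist (val e).1 (val e).2).
have surj e : exists h, forall e', dF e' (flat p) h = (e' == e)%:R.
  have [mu musym muE] := oriented_extension (fun e' : oriented_edge H => (e' == e)%:R / 2 : R).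
  have [w wE] := onto mu musym; exists (flat w) => e'; have /andP[He' _] := valP e'.
  have := wE _ _ He'; rewrite muE /dF -mulr_sumr /edge_derivative /dot => E.
  rewrite -[RHS](divfK (_ : 2 != 0)) ?pnatr_eq0 // -E mulrC; congr (_ * _).
  by apply: eq_bigr => l _; rewrite !mxE.
have [dl dl0 [C C0 [s [s0 sF sLip]]]] := local_right_inverse pF surj ltr01.
have Hab : H a b by rewrite /H /add_edge !eqxx orbT.
pose isab (e : oriented_edge H) : R := ((val e == (a, b)) || (val e == (b, a)))%:R.
pose y t (e : oriented_edge H) := F e (flat p) + clamp t * dl * isab e.
have isab01 e : 0 <= isab e <= 1 by rewrite /isab; case: (_ || _); rewrite ?lexx ?ler01.
have ybnd t : bounded_by (fun e => y t e - F e (flat p)) dl.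
  move=> e; rewrite /y addrC addKr; have /andP[c0 c1] := clamp01 t.
  have /andP[i0 i1] := isab01 e.
  rewrite ger0_norm ?mulr_ge0 // ?(ltW dl0) //.
  rewrite -[leRHS]mulr1 ler_pM // ?mulr_ge0 // ?(ltW dl0) //.
  by rewrite -[leRHS]mul1r ler_wpM2r // ltW.
pose f t := unflat (s (y t)).
have f0 : f 0 = p.
  rewrite /f (_ : y 0 = (fun e => F e (flat p))) ?s0.
    by apply/funext => v; apply/rowP => l; rewrite /unflat mxE.
  by apply/funext => e; rewrite /y clamp_id ?lexx ?ler01 // !mul0r addr0.
have fF t e : F e (flat (f t)) = y t e.
  by rewrite /f unflatK; have [] := sF _ (ybnd t).
have flen t c e : H c e ->
    sqdist (f t c) (f t e) = sqdist (p c) (p e) +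
      clamp t * dl * (((c, e) == (a, b)) || ((c, e) == (b, a)))%:R.
  move=> /(oriented_edgeP Hsym Hirr)[[k kE]|[k kE]]; have := fF t k; rewrite /y /isab /F kE /=.
    by move=> E; exact: E.
  rewrite [sqdist (f t c) _]sqdistC [sqdist (p c) _]sqdistC => E.
  rewrite [LHS]E; congr (_ + _ * _%:R); rewrite !xpair_eqE orbC.
  by rewrite andbC [X in _ || X]andbC.
have fcont v (i : 'I_d) : {within (`[0, 1] : set R), continuous (fun t => f t v 0 i)}%classic.
  apply: continuous_subspaceT => t.
  apply/cvgrPdist_le => e e0.
  near=> u.
  have mm : bounded_by (fun o => y t o - y u o) (dl * `|t - u|).
    move=> o; rewrite /y opprD addrACA subrr add0r -!mulrBl !normrM.
    have /andP[i0 i1] := isab01 o.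
    rewrite (ger0_norm i0) (gtr0_norm dl0) -[leRHS]mulr1 ler_pM // ?mulr_ge0 // ?(ltW dl0) //.
    by rewrite mulrC ler_wpM2l ?clamp_lipschitz ?(ltW dl0).
  have := sLip _ _ _ (mulr_ge0 (ltW dl0) (normr_ge0 _)) (ybnd t) (ybnd u) mm (v, i).
  rewrite /f /unflat !mxE => /le_trans; apply.
  rewrite mulrA; apply: (@le_trans _ _ ((C * dl + 1) * `|t - u|)).
    by rewrite ler_wpM2r // lerDl.
  rewrite mulrC -ler_pdivlMr; last by rewrite ltr_wpDl // mulr_ge0 // ltW.
  near: u; apply: cvgr_dist_le; first exact: cvg_id.
  by rewrite divr_gt0 // ltr_wpDl // mulr_ge0 // ltW.
have feq t : t \in `[0, 1] -> equivalent G p (f t).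
  move=> t01 c e Gce; rewrite flen /H /add_edge ?Gce //.
  rewrite (_ : _ || _ = false) ?mulr0 ?addr0 //; apply/negbTE/negP => /orP[] /eqP[cE eE].
    by rewrite cE eE (negPf nGab) in Gce.
  by rewrite cE eE Gsym (negPf nGab) in Gce.
have i01 : (1 : R) \in `[0, 1] by rewrite in_itv /= ler01 lexx.
have [T [Tiso TE]] := rig f fcont f0 feq 1 i01.
have := flen 1 a b Hab; rewrite !TE Tiso eqxx /= clamp_id ?ler01 ?lexx // mul1r mulr1.
by move/eqP; rewrite eq_sym -subr_eq0 addrC addKr gt_eqF.
Unshelve. all: by end_near.
Qed.

End Motions.

(** * Minimally rigid graphs *)

Section MinimallyRigid.
Variables (R : realType) (d : nat) (V : finType) (G : rel V).
Hypotheses (Gsym : symmetric G) (Girr : irreflexive G) (Gmin : min_d_rigid R d G).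
Implicit Types (p q w : realisation R d V).

Lemma min_rigid_stress_free_generic :
  exists p, [/\ generic p, rigid_fw G p & stress_free G p].
Proof.
have [[p [gp rig]] sep] := Gmin; exists p; split=> //.
apply: separated_edges_stress_free => // a b Gab.
exact: edge_separated (sep a b Gab).
Qed.

Lemma generic_onto p : generic p -> rigidity_map_onto G p.
Proof.
have [p0 [_ _ sf0]] := min_rigid_stress_free_generic.
by move=> gp; apply: stress_free_onto => //; apply: stress_free_generic sf0.
Qed.

(** Independence at [q] would pass to a generic rigid [p], where a motion of [G] could lengthen the
    new edge. This maximality of [G] replaces the count of edges. *)
Lemma nonedge_not_stress_free a b q :
  a != b -> ~~ G a b -> ~ stress_free (add_edge G a b) q.
Proof.
move=> ab nGab sf; have [p [gp rig _]] := min_rigid_stress_free_generic.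
have Hsym := add_edge_sym a b Gsym; have Hirr := add_edge_irr Girr ab.
apply: (flexible_of_independent_edge Gsym Girr ab nGab _ rig).
by apply: stress_free_onto => //; apply: stress_free_generic sf.
Qed.

(** If [w] changed the length of a nonedge [a b], adding multiples of [w] would adjust the
    derivative on [a b] at will, making the rigidity map of [G] with [a b] onto. *)
Lemma onto_infinitesimally_rigid q w : rigidity_map_onto G q ->
  (forall a b, G a b -> edge_derivative q w a b = 0) ->
  forall a b, edge_derivative q w a b = 0.
Proof.
move=> onto w0 a b; apply/eqP/negPn/negP => wab.
have ab : a != b.
  by apply: contraNneq wab => ->; rewrite /edge_derivative subrr dot0l.
have nGab : ~~ G a b by apply: contraNN wab => /w0 ->.
apply: (@nonedge_not_stress_free a b q ab nGab).
apply: rigidity_map_onto_stress_free => mu musym.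
have [w1 w1E] := onto mu musym.
pose t := (mu a b - edge_derivative q w1 a b) / edge_derivative q w a b.
exists (fun v => w1 v + t *: w v) => c e.
have E c' e' : edge_derivative q (fun v => w1 v + t *: w v) c' e' =
    edge_derivative q w1 c' e' + t * edge_derivative q w c' e'.
  by rewrite /edge_derivative -dotZr -dotDr; congr dot; rewrite scalerBr opprD addrACA.
have Eab : edge_derivative q (fun v => w1 v + t *: w v) a b = mu a b.
  by rewrite E /t divfK // addrC subrK.
case/or3P => [Gce|/andP[/eqP -> /eqP ->] //|/andP[/eqP -> /eqP ->]].
  by rewrite E w0 // mulr0 addr0 w1E.
by rewrite edge_derivativeC Eab musym.
Qed.

Definition spanning q : Prop :=
  forall z, (forall a b, dot z (q a - q b) = 0) -> z = 0.

(* If [q] lies in a hyperplane with normal [z] and [ab] is not an edge, moving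
   [b] off the hyperplane makes [G + ab] stress-free: the [z]-component of the
   equilibrium at [a] only sees the edge [ab]. *)
Lemma hyperplane_nonedge q z a b : z != 0 ->
  (forall c e, dot z (q c - q e) = 0) -> a != b -> stress_free G q ->
  stress_free (add_edge G a b) (fun v => q v + (v == b)%:R *: z).
Proof.
move=> z0 qz ab sf omega osym osupp oeq.
have zz : dot z z != 0 by apply: contraNneq z0 => /dot_eq0 ->.
have split c : \sum_e omega c e *: (q c - q e)
    + (\sum_e omega c e * ((c == b)%:R - (e == b)%:R)) *: z = 0.
  rewrite -[RHS](oeq c) scaler_suml -big_split; apply: eq_bigr => e _ /=.
  by rewrite opprD [in RHS]addrACA -scalerBl [RHS]scalerDr scalerA.
have vert c : \sum_e omega c e * ((c == b)%:R - (e == b)%:R) = 0.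
  have := congr1 (fun v => dot v z) (split c).
  rewrite dotDl dotZl dot0l dot_suml big1 => [/eqP|e _]; last by rewrite dotZl dotC qz mulr0.
  by rewrite add0r mulf_eq0 (negPf zz) orbF => /eqP.
have oab : omega a b = 0.
  have := vert a; rewrite (bigD1 b) //= big1 => [|e eb].
    by rewrite (negPf ab) eqxx /= sub0r mulrN1 addr0 => /eqP; rewrite oppr_eq0 => /eqP.
  by rewrite (negPf ab) (negPf eb) subrr mulr0.
apply: sf => // [c e nG|c]; last first.
  by have := split c; rewrite vert scale0r addr0.
have [|/osupp //] := boolP (add_edge G a b c e).
by rewrite /add_edge (negPf nG) /= => /orP[] /andP[/eqP -> /eqP ->] //; rewrite osym.
Qed.

(** The rows [(q v, 1)] have [d + 1] entries and are annihilated by a nonzero column, so their rank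
    is at most [d], less than the number of rows. *)
Lemma hyperplane_affine_dependence q z : z != 0 -> (d < #|V|)%N ->
  (forall c e, dot z (q c - q e) = 0) ->
  exists c : V -> R, [/\ exists v, c v != 0, \sum_v c v = 0 & \sum_v c v *: q v = 0].
Proof.
move=> z0 dV qz.
have v0 : V by apply: (enum_val (A := V)); exact: (Ordinal (leq_ltn_trans (leq0n d) dV)).
pose Q : 'M[R]_(#|V|, d) := \matrix_(i, j) q (enum_val i) 0 j.
pose M := row_mx Q (const_mx 1 : 'M[R]_(#|V|, 1)).
pose N : 'M[R]_(d + 1, 1) := col_mx z^T (const_mx (- dot z (q v0))).
have MN : M *m N = 0.
  rewrite mul_row_col; apply/matrixP => i j; rewrite !mxE big_ord1 !mxE mul1r.
  have := qz (enum_val i) v0; rewrite dotBr => E; rewrite -[RHS]E; congr (_ - _).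
  by apply: eq_bigr => l _; rewrite !mxE (ord1 j) mulrC.
have N0 : N != 0.
  apply: contraNneq z0 => /(congr1 usubmx); rewrite col_mxKu linear0 => /eqP.
  by rewrite trmx_eq0.
have rN : (0 < \rank N)%N by rewrite lt0n mxrank_eq0.
have rM : (\rank M < #|V|)%N.
  apply: leq_trans dV; rewrite -[d.+1]addn1; apply: leq_trans (mulmx0_rank_max MN).
  by rewrite -addn1 leq_add2l.
have kM : kermx M != 0 by rewrite -mxrank_eq0 mxrank_ker subn_eq0 -ltnNge.
have /rowV0Pn[u /sub_kermxP uM u0] := kM.
have [uQ u1] : u *m Q = 0 /\ u *m (const_mx 1 : 'M[R]_(#|V|, 1)) = 0.
  by move: uM; rewrite mul_mx_row => /eqP; rewrite row_mx_eq0 => /andP[/eqP ? /eqP ?].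
exists (fun v => u 0 (enum_rank v)); split.
- apply: contrapT => nex; case/eqP: u0; apply/rowP => i; rewrite mxE.
  apply/eqP/negPn/negP => h; apply: nex; exists (enum_val i).
  by rewrite enum_valK.
- have /matrixP/(_ 0 0) := u1; rewrite !mxE => E; rewrite -[RHS]E.
  rewrite (reindex (fun i : 'I_#|V| => enum_val i)) /=; last first.
    by exists enum_rank => i _; rewrite ?enum_valK ?enum_rankK.
  by apply: eq_bigr => i _; rewrite enum_valK mxE mulr1.
- apply/rowP => l; have /matrixP/(_ 0 l) := uQ; rewrite !mxE summxE => E; rewrite -[RHS]E.
  rewrite (reindex (fun i : 'I_#|V| => enum_val i)) /=; last first.
    by exists enum_rank => i _; rewrite ?enum_valK ?enum_rankK.
  by apply: eq_bigr => i _; rewrite !mxE enum_valK.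
Qed.

(* In a complete graph an affine dependence [c] is the stress [c a * c b]. *)
Lemma stress_free_spanning q : (d < #|V|)%N -> stress_free G q -> spanning q.
Proof.
move=> dV sf z qz; apply/eqP/negPn/negP => z0.
have [[a [b [ab nGab]]]|complete] := pselect (exists a b, a != b /\ ~~ G a b).
  exact: (nonedge_not_stress_free ab nGab (hyperplane_nonedge z0 qz ab sf)).
have [c [[v cv] c0 cq]] := hyperplane_affine_dependence z0 dV qz.
pose omega a b := if a == b then 0 else c a * c b.
have o0 : forall a b, omega a b = 0.
  apply: sf => [a b|a b nG|a].
  - by rewrite /omega eq_sym mulrC.
  - rewrite /omega; case: eqP => // /eqP ab; exfalso; apply: complete.
    by exists a, b.
  - transitivity (\sum_b (c a * c b) *: (q a - q b)).
      apply: eq_bigr => b _; rewrite /omega; case: eqP => // ->.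
      by rewrite subrr !scaler0.
    transitivity (c a *: ((\sum_b c b) *: q a - \sum_b c b *: q b)).
      rewrite scaler_suml -sumrB scaler_sumr; apply: eq_bigr => b _.
      by rewrite -scalerBr scalerA.
    by rewrite c0 cq scale0r subrr scaler0.
have : \sum_b c b = c v.
  rewrite (bigD1 v) //= big1 ?addr0 // => b bv.
  have := o0 v b; rewrite /omega eq_sym (negPf bv) => /eqP.
  by rewrite mulf_eq0 (negPf cv) => /eqP.
by rewrite c0 => E; rewrite -E eqxx in cv.
Qed.

End MinimallyRigid.

(** * Normals and linear systems of a star *)

Section Star.
Variables (R : realType) (d : nat) (V : finType).
Variables (q : realisation R d V) (x : V) (W : {set V}).

Definition star_matrix : 'M[R]_(#|W|, d) := \matrix_(i, j) (q x - q (enum_val i)) 0 j.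

Lemma star_normal : (#|W| < d)%N ->
  exists2 z, z != 0 & forall y, y \in W -> dot z (q x - q y) = 0.
Proof.
move=> Wd.
have kA : kermx star_matrix^T != 0.
  rewrite -mxrank_eq0 mxrank_ker subn_eq0 -ltnNge mxrank_tr.
  exact: leq_ltn_trans (rank_leq_row _) Wd.
have /rowV0Pn[z /sub_kermxP zA z0] := kA.
exists z => // y yW; have /matrixP/(_ 0 (enum_rank_in yW y)) := zA.
rewrite !mxE => E; rewrite -[RHS]E; apply: eq_bigr => l _.
by rewrite !mxE enum_rankK_in.
Qed.

Lemma star_unit_normal : (#|W| < d)%N ->
  exists2 n, dot n n = 1 & forall y, y \in W -> dot n (q x - q y) = 0.
Proof.
move=> /star_normal[z z0 zW].
have zz : 0 < dot z z.
  by rewrite lt_neqAle dot_ge0 andbT eq_sym; apply: contraNneq z0 => /dot_eq0 ->.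
exists ((Num.sqrt (dot z z))^-1 *: z).
  rewrite dotZl dotZr mulrA -expr2 exprVn sqr_sqrtr ?ltW // mulVf // gt_eqF //.
by move=> y yW; rewrite dotZl zW ?mulr0.
Qed.

Definition star_independent : Prop := forall c : V -> R,
  \sum_(y in W) c y *: (q x - q y) = 0 -> forall y, y \in W -> c y = 0.

(** A right inverse of [star_matrix] solves the equations at [W]; a multiple of [n] then adjusts
    [dot u n] without affecting them. *)
Lemma star_solve n (t : V -> R) s : star_independent ->
  dot n n = 1 -> (forall y, y \in W -> dot n (q x - q y) = 0) ->
  exists2 u, dot u n = s & forall y, y \in W -> dot u (q x - q y) = t y.
Proof.
move=> ind nn nW.
have Afree : row_free star_matrix.
  rewrite -kermx_eq0; apply/eqP/row_matrixP => i0; rewrite row0.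
  have : row i0 (kermx star_matrix) *m star_matrix = 0 by apply/sub_kermxP; exact: row_sub.
  move: (row _ _) => v vA.
  pose c (y : V) := \sum_(i | enum_val i == y) v 0 i.
  have cE i : c (enum_val i) = v 0 i.
    rewrite /c (bigD1 i) //= big1 ?addr0 // => k /andP[/eqP/enum_val_inj ->].
    by rewrite eqxx.
  apply/rowP => i; rewrite [RHS]mxE -cE; apply: ind; last exact: enum_valP.
  apply/rowP => l; have /matrixP/(_ 0 l) := vA; rewrite !mxE summxE => E.
  rewrite -[RHS]E big_enum_val /=; apply: eq_bigr => k _.
  by rewrite [in LHS]mxE cE [star_matrix _ _]mxE.
have [B AB] := row_freeP Afree.
pose u0 : 'rV[R]_d := (B *m \col_i t (enum_val i))^T.
have u0W y : y \in W -> dot u0 (q x - q y) = t y.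
  move=> yW.
  have /matrixP/(_ (enum_rank_in yW y) 0) : star_matrix *m (B *m \col_i t (enum_val i)) = \col_i t (enum_val i).
    by rewrite mulmxA AB mul1mx.
  rewrite [RHS]mxE enum_rankK_in // => <-; rewrite [RHS]mxE.
  apply: eq_bigr => l _; rewrite [star_matrix _ _]mxE enum_rankK_in // mulrC.
  by congr (_ * _); rewrite /u0 mxE.
exists (u0 + (s - dot u0 n) *: n); first by rewrite dotDl dotZl nn mulr1 addrC subrK.
by move=> y yW; rewrite dotDl dotZl nW // mulr0 addr0 u0W.
Qed.

End Star.

(** * Linear independence of stars in equivalent realisations *)

Section StarIndependent.
Variables (R : realType) (d : nat) (V : finType) (G : rel V).
Hypotheses (Gsym : symmetric G) (Girr : irreflexive G) (Gmin : min_d_rigid R d G).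
Variables (p q : realisation R d V) (x : V) (W : {set V}).

(* Let [z] be normal to the star and give one vertex [y0] of it the velocity
   [z].  Modulo an infinitesimal isometry this velocity field comes from a
   derivation [D] of the reals; differentiating the relation and pairing it with
   [z] leaves [c y0 * dot z z]. *)
Lemma equivalent_star_independent : (d < #|V|)%N -> (#|W| < d)%N -> x \notin W ->
  generic p -> equivalent G p q -> star_independent q x W.
Proof.
move=> dV Wd xW gp pq c crel y0 y0W; apply/eqP/negPn/negP => cy0.
have pon := generic_onto Gsym Girr Gmin gp.
have qon := equivalent_onto gp pon pq.
have span : spanning q.
  by apply: (stress_free_spanning Gsym Girr Gmin) => //; exact: rigidity_map_onto_stress_free.
have [z z0 zW] := star_normal q x Wd.
pose w : realisation R d V := fun v => if v == y0 then z else 0.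
have [D Dd DE] := generic_equivalent_derivation gp pon pq (edge_derivativeC q w).
pose k v := w v - map_mx D (q v).
have k0 : forall a b, edge_derivative q k a b = 0.
  apply: (onto_infinitesimally_rigid Gsym Girr Gmin qon) => a b Gab.
  have := DE a b Gab; rewrite /edge_derivative /k => E.
  have -> : w a - map_mx D (q a) - (w b - map_mx D (q b)) =
    (w a - w b) - (map_mx D (q a) - map_mx D (q b)).
    by rewrite !opprB addrACA [RHS]addrACA; congr (_ + _); rewrite addrC.
  by rewrite dotBr E subrr.
(* An infinitesimal isometry acts on differences like a skew matrix; with spanning, [k] therefore
   satisfies the same linear relation as [q]. *)
have polar y b : dot (k x - k y) (q b - q x) = - dot (q x - q y) (k b - k x).
  have gen (A B A' B' : 'rV[R]_d) : dot A A' = 0 -> dot B B' = 0 ->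
      dot (B + A) (B' + A') = 0 -> dot A' B = - dot A B'.
    by rewrite !dotDl !dotDr (dotC A' B); lra.
  by apply: gen (k0 x y) (k0 b x) _; rewrite !subrKA; exact: k0 b y.
have ksum : \sum_(y in W) c y *: (k x - k y) = 0.
  apply: span => a b.
  have dx e : dot (\sum_(y in W) c y *: (k x - k y)) (q e - q x) = 0.
    transitivity (- dot (\sum_(y in W) c y *: (q x - q y)) (k e - k x)); last by rewrite crel dot0l oppr0.
    rewrite !dot_suml -sumrN; apply: eq_bigr => y _.
    by rewrite !dotZl polar mulrN.
  have -> : q a - q b = (q a - q x) - (q b - q x) by rewrite opprB addrA subrK.
  by rewrite dotBr !dx subrr.
have [DD DM] := Dd.
have Drel : \sum_(y in W) D (c y) *: (q x - q y) +
    \sum_(y in W) c y *: (map_mx D (q x) - map_mx D (q y)) = 0.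
  rewrite -big_split; apply/rowP => l; rewrite summxE mxE.
  have /(congr1 (fun v : 'rV[R]_d => D (v 0 l))) := crel.
  rewrite summxE mxE (derivation0 Dd) (big_morph D DD (derivation0 Dd)) => E.
  rewrite -[RHS]E; apply: eq_bigr => y _ /=.
  by rewrite !mxE DM (derivationB _ _ Dd).
(* The terms with [D (c y)] are multiples of star vectors, to which [z] is normal. *)
have DW : dot (\sum_(y in W) c y *: (map_mx D (q x) - map_mx D (q y))) z = 0.
  have := congr1 (fun v => dot v z) Drel; rewrite dotDl dot0l dot_suml big1 ?add0r // => y yW.
  by rewrite dotZl dotC zW // mulr0.
have wW : dot (\sum_(y in W) c y *: (w x - w y)) z = 0.
  transitivity (dot (\sum_(y in W) c y *: (map_mx D (q x) - map_mx D (q y)) +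
    \sum_(y in W) c y *: (k x - k y)) z); last by rewrite dotDl DW ksum dot0l addr0.
  rewrite -big_split; congr dot; apply: eq_bigr => y _ /=; rewrite -scalerDr; congr (_ *: _).
  by rewrite /k [RHS]addrACA -opprD !(addrC (map_mx D _)) !subrK.
move/eqP: wW; rewrite dot_suml (bigD1 y0) //= big1 ?addr0 => [|y /andP[yW yy0]].
  have xy0 : (x == y0) = false by apply: contraNF xW => /eqP ->.
  rewrite dotZl /w xy0 eqxx sub0r dotNl mulrN oppr_eq0 mulf_eq0 (negPf cy0) /=.
  by apply/negP; apply: contraNN z0 => /eqP/dot_eq0 ->.
have xy0 : (x == y0) = false by apply: contraNF xW => /eqP ->.
by rewrite dotZl /w xy0 (negPf yy0) subrr dot0l mulr0.
Qed.

End StarIndependent.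

(** * Congruence *)

Section Congruence.
Variables (R : realType) (d : nat) (V : finType).
Implicit Types (p q : realisation R d V).

Lemma dot_mulmx (u v : 'rV[R]_d) : dot u v = (u *m v^T) 0 0.
Proof. by rewrite mxE; apply: eq_bigr => l _; rewrite mxE. Qed.

Lemma mul_mx_tr_eq0 (m n : nat) (A : 'M[R]_(m, n)) : A *m A^T = 0 -> A = 0.
Proof.
move=> A0; apply/row_matrixP => i; rewrite row0; apply: dot_eq0.
have /matrixP/(_ i i) := A0; rewrite !mxE => E; rewrite -[RHS]E.
by apply: eq_bigr => l _; rewrite !mxE.
Qed.

Lemma congruent_sqdist p q : congruent p q ->
  forall a b, sqdist (q a) (q b) = sqdist (p a) (p b).
Proof. by move=> [T [Tiso TE]] a b; rewrite !TE Tiso. Qed.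

(** Equal distances give equal Gram matrices of the vectors from [x]. As [p] spans, [B p] has a left
    inverse [C], and [C *m B q] is the orthogonal matrix that carries [B p] to [B q]. *)
Lemma sqdist_congruent p q (x : V) : spanning p ->
  (forall a b, sqdist (p a) (p b) = sqdist (q a) (q b)) -> congruent p q.
Proof.
move=> span pq.
pose B (r : realisation R d V) : 'M[R]_(#|V|, d) := \matrix_(i, j) (r (enum_val i) - r x) 0 j.
have rowB r v : row (enum_rank v) (B r) = r v - r x.
  by apply/rowP => l; rewrite !mxE enum_rankK.
have gram : B p *m (B p)^T = B q *m (B q)^T.
  have E r i j : (B r *m (B r)^T) i j = 2^-1 * (sqdist (r (enum_val i)) (r x)
      + sqdist (r (enum_val j)) (r x) - sqdist (r (enum_val i)) (r (enum_val j))).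
    rewrite mxE /sqdist -big_split /= -sumrB mulr_sumr; apply: eq_bigr => l _.
    by rewrite !mxE; field.
  by apply/matrixP => i j; rewrite !E !pq.
have /row_fullP[C CB] : row_full (B p).
  rewrite /row_full -mxrank_tr -[_ == _]/(row_free _) -kermx_eq0.
  apply/eqP/row_matrixP => i0; rewrite row0.
  have : row i0 (kermx (B p)^T) *m (B p)^T = 0 by apply/sub_kermxP; exact: row_sub.
  move: (row _ _) => z zB; apply: span => a b.
  have zx v : dot z (p v - p x) = 0.
    rewrite -rowB; have /matrixP/(_ 0 (enum_rank v)) := zB; rewrite !mxE => E.
    by rewrite -[RHS]E; apply: eq_bigr => l _; rewrite !mxE.
  have -> : p a - p b = (p a - p x) - (p b - p x) by rewrite opprB addrA subrK.
  by rewrite dotBr !zx subrr.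
pose O := C *m B q.
have OO : O *m O^T = 1%:M.
  by rewrite /O trmx_mul mulmxA -(mulmxA C) -gram mulmxA CB mul1mx -trmx_mul CB trmx1.
have BO : B p *m O = B q.
  apply/eqP; rewrite -subr_eq0; apply/eqP.
  have -> : B p *m O - B q = (B p *m C - 1%:M) *m B q by rewrite mulmxBl mul1mx mulmxA.
  apply: mul_mx_tr_eq0.
  have : (B p *m C - 1%:M) *m B p = 0 by rewrite mulmxBl mul1mx -mulmxA CB mulmx1 subrr.
  move: (B p *m C - 1%:M) => X X0.
  by rewrite trmx_mul mulmxA -(mulmxA _ (B q)) -gram mulmxA X0 !mul0mx.
exists (fun y => (y - p x) *m O + q x); split=> [a b|v].
  rewrite !sqdistE opprD addrACA subrr addr0 -mulmxBl opprB addrA subrK.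
  by rewrite !dot_mulmx trmx_mul mulmxA -(mulmxA _ O) OO mulmx1.
by rewrite -rowB -row_mul BO rowB subrK.
Qed.

End Congruence.

(** * The equations of the split graph *)

Section SplitEquations.
Variables (R : realType) (d : nat) (V : finType) (G : rel V).
Hypotheses (Gsym : symmetric G) (Girr : irreflexive G).
Variables (x : V) (N1 N2 W : {set V}).
Hypothesis part : split_partition G d x N1 N2 W.

(* A state is a triple (eps, q, u): it encodes the realisation of the split
   graph with [x_1 = q x] and [x_2 = q x + eps u], see [split_realisation]. *)
Definition state_index : finType := option (option V * 'I_d).
Local Notation state := (state_index -> R).
Implicit Types X : state.

Definition split_eps X : R := X None.
Definition split_base X : realisation R d V := fun v => \row_l X (Some (Some v, l)).
Definition split_dir X : 'rV[R]_d := \row_l X (Some (None, l)).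

Definition mk_state (e : R) (q : realisation R d V) (u : 'rV[R]_d) : state :=
  fun j => match j with
  | None => e
  | Some (Some v, l) => q v 0 l
  | Some (None, l) => u 0 l
  end.

Lemma mk_state_base e q u : split_base (mk_state e q u) = q.
Proof. by apply/funext => v; apply/rowP => l; rewrite mxE. Qed.

Lemma mk_state_dir e q u : split_dir (mk_state e q u) = u.
Proof. by apply/rowP => l; rewrite mxE. Qed.

Definition split_realisation X : realisation R d (option V) := fun a =>
  match a with
  | Some v => split_base X v
  | None => split_base X x + split_eps X *: split_dir X
  end.

Lemma split_realisationK e (r : realisation R d (option V)) : e != 0 ->
  split_realisation (mk_state e (fun v => r (Some v)) (e^-1 *: (r None - r (Some x)))) = r.
Proof.
move=> e0; apply/funext => -[v|]; rewrite /split_realisation !mk_state_base // mk_state_dir.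
by rewrite /split_eps /= scalerA mulfV // scale1r addrC subrK.
Qed.

(** Edges from [x] to [N2] are attached to [x_2] after the split; this is the sign with which eps
    times [u] enters the difference along such an edge. *)
Definition split_sign (a b : V) : R :=
  ((a == x) && (b \in N2))%:R - ((b == x) && (a \in N2))%:R.

Lemma rational_split_sign a b : rational (split_sign a b).
Proof.
exists (((a == x) && (b \in N2))%:R - ((b == x) && (a \in N2))%:R).
by rewrite rmorphB /= !ratr_nat.
Qed.

(** The parameter eps is itself one of the equations, so that a right-hand side prescribes it and
    all states solving the same system share it. *)
Definition split_equation_index : finType :=
  option (option (oriented_edge G + {y | y \in W})).

Definition split_edge (e : V * V) X : R :=
  \sum_l (X (Some (Some e.1, l)) - X (Some (Some e.2, l)) +
          split_sign e.1 e.2 * (X None * X (Some (None, l)))) ^+ 2.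

(* The equation at [w] in [W] is the difference of the equations of the edges
   [x_2 w] and [x_1 w], divided by eps; [x_1 x_2] gives the equation |u|^2. *)
Definition split_equation (i : split_equation_index) X : R :=
  match i with
  | None => X None
  | Some None => \sum_l X (Some (None, l)) ^+ 2
  | Some (Some (inl e)) => split_edge (val e) X
  | Some (Some (inr y)) => \sum_l (2 * (X (Some (None, l)) *
      (X (Some (Some x, l)) - X (Some (Some (val y), l)))) +
      X None * X (Some (None, l)) ^+ 2)
  end.

Definition d_split_equation (i : split_equation_index) X h : R :=
  match i with
  | None => h None
  | Some None => \sum_l 2 * (X (Some (None, l)) * h (Some (None, l)))
  | Some (Some (inl e)) =>
      let a := (val e).1 in let b := (val e).2 in
      \sum_l 2 * ((X (Some (Some a, l)) - X (Some (Some b, l)) +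
          split_sign a b * (X None * X (Some (None, l)))) *
        (h (Some (Some a, l)) - h (Some (Some b, l)) + split_sign a b *
          (h None * X (Some (None, l)) + X None * h (Some (None, l)))))
  | Some (Some (inr y)) => \sum_l
      (2 * (h (Some (None, l)) * (X (Some (Some x, l)) - X (Some (Some (val y), l))) +
       X (Some (None, l)) * (h (Some (Some x, l)) - h (Some (Some (val y), l)))) +
       (h None * X (Some (None, l)) ^+ 2 +
        X None * (2 * (X (Some (None, l)) * h (Some (None, l))))))
  end.

Lemma polyfun_split_equation i :
  polyfun (@any R) (split_equation i) (d_split_equation i).
Proof.
apply: (@polyfun_any _ _ (@rational R)).
pose pv (j : state_index) : polyfun (@rational R) (fun X : state => X j) (fun _ h => h j) :=
  polyfun_var (@rational R) j.
case: i => [[[e|y]|]|] /=; last exact: pv.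
- apply: polyfun_sum => l; apply: polyfun_sqr.
  have := polyfun_add (polyfun_sub (pv (Some (Some (val e).1, l))) (pv (Some (Some (val e).2, l))))
    (polyfun_mul (polyfun_cst _ (rational_split_sign (val e).1 (val e).2))
       (polyfun_mul (pv None) (pv (Some (None, l))))).
  by move/polyfun_eq; apply=> // X h; rewrite mul0r add0r.
- apply: polyfun_sum => l; apply: polyfun_add; last first.
    apply: polyfun_mul; first exact: pv.
    by apply: polyfun_sqr; exact: pv.
  have := polyfun_mul (polyfun_cst state_index (rational_nat R 2))
    (polyfun_mul (pv (Some (None, l)))
       (polyfun_sub (pv (Some (Some x, l))) (pv (Some (Some (val y), l))))).
  by move/polyfun_eq; apply=> // X h; rewrite mul0r add0r.
- by apply: polyfun_sum => l; apply: polyfun_sqr; exact: pv.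
Qed.

Lemma split_sign0 a b : ~~ ((a == x) && (b \in N2)) -> ~~ ((b == x) && (a \in N2)) ->
  split_sign a b = 0.
Proof. by rewrite /split_sign => /negPf -> /negPf ->; rewrite subrr. Qed.

Lemma partP :
  [/\ forall y, G x y = [|| y \in N1, y \in N2 | y \in W],
      forall y, y \in N1 -> y \notin N2, forall y, y \in N2 -> y \notin W & x \notin W].
Proof.
have [D12 D1W D2W E _] := part.
have GE y : G x y = [|| y \in N1, y \in N2 | y \in W].
  by have := congr1 (fun A : {set V} => y \in A) E; rewrite !inE orbA.
split=> // [y y1|y y2|].
- by rewrite (disjointFr D12 y1).
- by rewrite (disjointFr D2W y2).
- by apply/negP => xW; have := GE x; rewrite Girr xW !orbT.
Qed.

Lemma split_edgeC a b X : split_edge (a, b) X = split_edge (b, a) X.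
Proof. by apply: eq_bigr => l _; rewrite /split_sign /=; ring. Qed.

Lemma split_edge_sqdist a b X : split_sign a b = 0 ->
  split_edge (a, b) X = sqdist (split_base X a) (split_base X b).
Proof. by move=> s0; apply: eq_bigr => l _; rewrite s0 mul0r addr0 !mxE. Qed.

(** The squared length of [x_1 x_2] is the square of eps times the equation for [u]; that of
    [x_2 w], for [w] in [W], is the equation of the edge [x w] plus eps times the equation at
    [w]. *)
Lemma equal_equations_equivalent X Y : (forall i, split_equation i X = split_equation i Y) ->
  equivalent (vertex_split G x N1 N2 W) (split_realisation X) (split_realisation Y).
Proof.
move=> XY; have [GE N12 N2W xW] := partP.
have eE : X None = Y None := XY None.
have uE := XY (Some None).
have edgeE a b : G a b -> split_edge (a, b) X = split_edge (a, b) Y.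
  by case/(oriented_edgeP Gsym Girr) => -[k kE]; have := XY (Some (Some (inl k)));
    rewrite /split_equation kE // split_edgeC => ->; rewrite split_edgeC.
have base a b : G a b -> split_sign a b = 0 ->
    sqdist (split_base X a) (split_base X b) = sqdist (split_base Y a) (split_base Y b).
  by move=> Gab s0; rewrite -!split_edge_sqdist // edgeE.
have star y : (y == x) || (y \in N2 :|: W) ->
    sqdist (split_realisation X (Some y)) (split_realisation X None) =
    sqdist (split_realisation Y (Some y)) (split_realisation Y None).
  rewrite !inE => /or3P[/eqP ->|y2|yW].
  - have E Z : sqdist (split_realisation Z (Some x)) (split_realisation Z None) =
        Z None ^+ 2 * \sum_l Z (Some (None, l)) ^+ 2.
      by rewrite mulr_sumr; apply: eq_bigr => l _; rewrite !mxE /split_eps; ring.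
    by rewrite !E eE; congr (_ * _).
  - have yx : (y == x) = false.
      by apply/eqP => yx; have := GE x; rewrite Girr -yx y2 orbT.
    have Gxy : G x y by rewrite GE y2 orbT.
    have E Z : sqdist (split_realisation Z (Some y)) (split_realisation Z None) =
        split_edge (x, y) Z.
      apply: eq_bigr => l _; rewrite !mxE /split_eps /split_sign /= eqxx y2 yx /=.
      by ring.
    by rewrite !E edgeE.
  - have y2 : y \in N2 = false by apply/negP => /N2W; rewrite yW.
    have yx : (y == x) = false by apply: contraNF xW => /eqP <-.
    have Gxy : G x y by rewrite GE yW !orbT.
    have s0 : split_sign x y = 0 by apply: split_sign0; rewrite ?y2 ?andbF ?yx.
    pose yy : {y | y \in W} := Sub y yW.
    have E Z : sqdist (split_realisation Z (Some y)) (split_realisation Z None) =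
        split_edge (x, y) Z + Z None * split_equation (Some (Some (inr yy))) Z.
      rewrite /split_equation /split_edge mulr_sumr -big_split /=.
      by apply: eq_bigr => l _; rewrite s0 !mxE /split_eps /=; ring.
    by rewrite !E edgeE // XY eE.
move=> [a|] [b|] //=.
- case: (eqVneq a x) => [->|ax].
    case/andP => bx; rewrite inE => bN1W.
    have b2 : b \in N2 = false.
      by apply/negP => b2; case/orP: bN1W => [/N12|bW]; [rewrite b2 | have := N2W _ b2; rewrite bW].
    apply: base; first by rewrite GE; case/orP: bN1W => ->; rewrite ?orbT.
    by apply: split_sign0; rewrite ?b2 ?andbF // (negPf bx).
  case: (eqVneq b x) => [->|bx].
    rewrite inE => aN1W.
    have a2 : a \in N2 = false.
      by apply/negP => a2; case/orP: aN1W => [/N12|aW]; [rewrite a2 | have := N2W _ a2; rewrite aW].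
    rewrite sqdistC [RHS]sqdistC; apply: base; first by rewrite GE; case/orP: aN1W => ->; rewrite ?orbT.
    by apply: split_sign0; rewrite ?a2 ?andbF // (negPf ax).
  by move=> Gab; apply: base => //; apply: split_sign0; rewrite ?(negPf ax) ?(negPf bx).
- by move=> H; apply: star; move: H; case: (a == x).
- by move=> H; rewrite sqdistC [RHS]sqdistC; apply: star; move: H; case: (b == x).
Qed.

Lemma split_equation_initial (p q : realisation R d V) n n' i : equivalent G p q ->
  dot n n = 1 -> (forall y, y \in W -> dot n (p x - p y) = 0) ->
  dot n' n' = 1 -> (forall y, y \in W -> dot n' (q x - q y) = 0) ->
  split_equation i (mk_state 0 p n) = split_equation i (mk_state 0 q n').
Proof.
move=> pq nn nW nn' nW'; case: i => [[[e|y]|]|] //=.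
- have E (r : realisation R d V) (m : 'rV[R]_d) : split_edge (val e) (mk_state 0 r m) = sqdist (r (val e).1) (r (val e).2).
    by apply: eq_bigr => l _; rewrite /= mul0r mulr0 addr0.
  by rewrite !E pq //; have /andP[] := valP e.
- have E (r : realisation R d V) (m : 'rV[R]_d) : \sum_(l < d) (2 * (m 0 l * (r x 0 l - r (val y) 0 l)) + 0 * m 0 l ^+ 2) =
      2 * dot m (r x - r (val y)).
    by rewrite /dot mulr_sumr; apply: eq_bigr => l _; rewrite !mxE; ring.
  by rewrite !E nW ?nW' ?(valP y).
- have E (m : 'rV[R]_d) : \sum_l m 0 l ^+ 2 = dot m m.
    by apply: eq_bigr => l _; rewrite expr2.
  by rewrite !E nn nn'.
Qed.

(** The differential is triangular at eps equal to 0: [t0] is prescribed, the velocity [w] of the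
    base serves the edges after correction by [t0], and the direction [u] serves the equations at
    [W] and of its norm. *)
Lemma split_equation_onto (q : realisation R d V) n :
  rigidity_map_onto G q -> star_independent q x W ->
  dot n n = 1 -> (forall y, y \in W -> dot n (q x - q y) = 0) ->
  forall i, exists h, forall i', d_split_equation i' (mk_state 0 q n) h = (i' == i)%:R.
Proof.
move=> onto ind nn nW i0.
pose tgt (i : split_equation_index) : R := (i == i0)%:R.
pose t0 := tgt None.
have [mu musym muE] := oriented_extension (fun e : oriented_edge G =>
  tgt (Some (Some (inl e))) / 2 - split_sign (val e).1 (val e).2 * t0 *
    dot (q (val e).1 - q (val e).2) n).
have [w wE] := onto mu musym.
pose tW y := oapp (fun y' => (tgt (Some (Some (inr y'))) - t0 * dot n n) / 2) 0 (insub y)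
   - dot n (w x - w y).
have [u un uW] := star_solve tW (tgt (Some None) / 2) ind nn nW.
exists (mk_state t0 w u) => i; rewrite -/(tgt i).
case: i => [[[e|y]|]|] //=.
- transitivity (2 * (edge_derivative q w (val e).1 (val e).2 +
     split_sign (val e).1 (val e).2 * t0 * dot (q (val e).1 - q (val e).2) n)).
    rewrite /edge_derivative /dot mulr_sumr -big_split /= mulr_sumr.
    by apply: eq_bigr => l _; rewrite !mxE; ring.
  have /andP[Ge _] := valP e; rewrite wE // muE subrK mulrC divfK // pnatr_eq0.
- transitivity (2 * (dot u (q x - q (val y)) + dot n (w x - w (val y))) + t0 * dot n n).
    rewrite /dot -big_split /= !mulr_sumr -big_split /=.
    by apply: eq_bigr => l _; rewrite !mxE; ring.
  by rewrite uW ?(valP y) // /tW valK /= subrK; lra.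
- transitivity (2 * dot u n); last by rewrite un; lra.
  by rewrite /dot mulr_sumr; apply: eq_bigr => l _; ring.
Qed.

Lemma split_congruent_sqdist X Y : congruent (split_realisation X) (split_realisation Y) ->
  forall a b, sqdist (split_base X a) (split_base X b) = sqdist (split_base Y a) (split_base Y b).
Proof. by move=> XY a b; have := congruent_sqdist XY (Some a) (Some b). Qed.

(** Polarisation: since eps is nonzero, this scalar product is read off from the distances between
    [x_1], [x_2] and [v]. *)
Lemma split_congruent_dir X Y : congruent (split_realisation X) (split_realisation Y) ->
  X None = Y None -> X None != 0 -> forall v,
  dot (split_dir X) (split_base X v - split_base X x) =
  dot (split_dir Y) (split_base Y v - split_base Y x).
Proof.
move=> XY eE e0 v; have D := congruent_sqdist XY.
have E Z : 2 * (Z None * dot (split_dir Z) (split_base Z v - split_base Z x)) =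
    sqdist (split_realisation Z (Some v)) (split_realisation Z (Some x)) +
    sqdist (split_realisation Z None) (split_realisation Z (Some x)) -
    sqdist (split_realisation Z None) (split_realisation Z (Some v)).
  rewrite /sqdist /dot !mulr_sumr -big_split -sumrB; apply: eq_bigr => l _ /=.
  by rewrite !mxE /split_eps; ring.
have := E Y; rewrite -eE !D -E => /(mulfI (_ : 2 != 0)).
by rewrite pnatr_eq0 => /(_ isT)/(mulfI e0).
Qed.

End SplitEquations.

(** * Doubling the number of realisations *)

Lemma polyfun_separate (R : realType) (J : finType) C f df (X0 Y0 : J -> R) :
  polyfun C f df -> f X0 != f Y0 -> exists2 r, 0 < r & forall X Y,
    bounded_by (fun j => X j - X0 j) r -> bounded_by (fun j => Y j - Y0 j) r ->
    f X != f Y.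
Proof.
move=> pf ne.
have e0 : 0 < `|f X0 - f Y0| / 3 by rewrite divr_gt0 // normr_gt0 subr_eq0.
have [r1 r10 H1] := polyfun_continuous pf X0 e0.
have [r2 r20 H2] := polyfun_continuous pf Y0 e0.
exists (Num.min r1 r2); first by rewrite lt_min r10.
move=> X Y hX hY; apply/eqP => E.
have m1 : Num.min r1 r2 <= r1 by rewrite ge_min lexx.
have m2 : Num.min r1 r2 <= r2 by rewrite ge_min lexx orbT.
have A1 := H1 X (fun j => le_trans (hX j) m1).
have A2 := H2 Y (fun j => le_trans (hY j) m2).
have : `|f X0 - f Y0| <= `|f X - f X0| + `|f Y - f Y0|.
  rewrite -[X in _ <= X + _]normrN; apply: le_trans (ler_normD _ _).
  by rewrite E opprB addrA subrK.
lra.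
Qed.

Lemma classes_ge_fin (R : realType) (d : nat) (V : finType) (G : rel V)
  (p : realisation R d V) (T : finType) (q : T -> realisation R d V) :
  (forall t, equivalent G p (q t)) ->
  (forall t t', t != t' -> ~ congruent (q t) (q t')) -> classes_ge G p #|T|.
Proof.
move=> pq nq; exists (fun i => q (enum_val i)); split=> // i j ij.
by apply: nq; apply: contraNneq ij => /enum_val_inj ->.
Qed.

Section Doubling.
Variables (R : realType) (d : nat) (V : finType) (G : rel V).
Variables (x : V) (N1 N2 W : {set V}).
Hypotheses (d_gt0 : (0 < d)%N) (Gsym : symmetric G) (Girr : irreflexive G).
Hypotheses (Gmin : min_d_rigid R d G) (dV : (d < #|V|)%N).
Hypothesis part : split_partition G d x N1 N2 W.
Local Notation G' := (vertex_split G x N1 N2 W).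
Local Notation real_of := (@split_realisation R d V x).

Definition unit_normal (q : realisation R d V) (n : 'rV[R]_d) : Prop :=
  dot n n = 1 /\ forall y, y \in W -> dot n (q x - q y) = 0.

Lemma unit_normal_exists (q : realisation R d V) : exists n, unit_normal q n.
Proof.
have Wd : (#|W| < d)%N by have [_ _ _ _ ->] := part; rewrite prednK.
by have [n nn nW] := star_unit_normal q x Wd; exists n.
Qed.

Variable p : realisation R d V.
Hypothesis gp : generic p.

Lemma split_solvable q n r : equivalent G p q -> unit_normal q n -> 0 < r ->
  exists2 delta, 0 < delta & forall y : split_equation_index G W -> R,
    bounded_by (fun i => y i - split_equation x N2 i (mk_state 0 q n)) delta ->
    exists2 X : state_index d V -> R, forall i, split_equation x N2 i X = y i &
      bounded_by (fun j => X j - mk_state 0 q n j) r.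
Proof.
move=> pq [nn nW] r0.
have Wd : (#|W| < d)%N by have [_ _ _ _ ->] := part; rewrite prednK.
have [_ _ _ xW] := partP Girr part.
have pon := generic_onto Gsym Girr Gmin gp.
have qon := equivalent_onto gp pon pq.
have ind := equivalent_star_independent Gsym Girr Gmin dV Wd xW gp pq.
have surj := split_equation_onto N2 qon ind nn nW.
have [dl dl0 [_ _ [s [_ sP _]]]] :=
  local_right_inverse (@polyfun_split_equation R d V G x N2 W) surj r0.
exists dl => // y /sP[sE sb]; by exists (s y).
Qed.

Lemma equivalent_spanning q : equivalent G p q -> spanning q.
Proof.
move=> pq; apply: (stress_free_spanning Gsym Girr Gmin) => //.
apply: rigidity_map_onto_stress_free.
exact: equivalent_onto gp (generic_onto Gsym Girr Gmin gp) pq.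
Qed.

Lemma polyfun_base_sqdist a b : polyfun (@rational R)
  (fun X : state_index d V -> R => sqdist (split_base X a) (split_base X b))
  (fun X h => \sum_l 2 * ((X (Some (Some a, l)) - X (Some (Some b, l))) *
     (h (Some (Some a, l)) - h (Some (Some b, l))))).
Proof.
have pf : polyfun (@rational R) (fun X : state_index d V -> R =>
    \sum_l (X (Some (Some a, l)) - X (Some (Some b, l))) ^+ 2)
  (fun X h => \sum_l 2 * ((X (Some (Some a, l)) - X (Some (Some b, l))) *
     (h (Some (Some a, l)) - h (Some (Some b, l))))).
  apply: polyfun_sum => l; apply: polyfun_sqr.
  by apply: polyfun_sub; apply: polyfun_var.
by apply: polyfun_eq pf _ _ => // X; apply: eq_bigr => l _; rewrite !mxE.
Qed.

Lemma polyfun_base_dir v : exists df, polyfun (@rational R)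
  (fun X : state_index d V -> R =>
     dot (split_dir X) (split_base X v - split_base X x)) df.
Proof.
have pf l : polyfun (@rational R) (fun X : state_index d V -> R =>
    X (Some (None, l)) * (X (Some (Some v, l)) - X (Some (Some x, l)))) _ :=
  polyfun_mul (polyfun_var _ _) (polyfun_sub (polyfun_var _ _) (polyfun_var _ _)).
eexists; apply: polyfun_eq (polyfun_sum (index_enum 'I_d) pf) _ _ => // X.
by apply: eq_bigr => l _; rewrite !mxE.
Qed.

Lemma separate_distances q q' n n' : equivalent G p q -> ~ congruent q q' ->
  exists2 r, 0 < r & forall X Y : state_index d V -> R,
    bounded_by (fun j => X j - mk_state 0 q n j) r ->
    bounded_by (fun j => Y j - mk_state 0 q' n' j) r ->
    ~ congruent (real_of X) (real_of Y).
Proof.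
move=> pq ncong.
have [a [b ab]] : exists a b, sqdist (q a) (q b) <> sqdist (q' a) (q' b).
  apply: contrapT => nex; apply: ncong; apply: (sqdist_congruent x (equivalent_spanning pq)) => a b.
  by apply: contrapT => ne; apply: nex; exists a, b.
have ne : sqdist (split_base (mk_state 0 q n) a) (split_base (mk_state 0 q n) b) !=
    sqdist (split_base (mk_state 0 q' n') a) (split_base (mk_state 0 q' n') b).
  by rewrite !mk_state_base; exact/eqP.
have [r r0 rP] := polyfun_separate (polyfun_base_sqdist a b) ne.
exists r => // X Y hX hY /split_congruent_sqdist/(_ a b) E.
by have := rP X Y hX hY; rewrite E eqxx.
Qed.

(** Both states have base near [q], so distances in the base need not separate them. Since [q]
    spans, [n] has a nonzero product with some [q v - q x], and this product changes sign with
    [n]. *)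
Lemma separate_normals q n : equivalent G p q -> unit_normal q n ->
  exists2 r, 0 < r & forall X Y : state_index d V -> R,
    bounded_by (fun j => X j - mk_state 0 q n j) r ->
    bounded_by (fun j => Y j - mk_state 0 q (- n) j) r ->
    X None = Y None -> X None != 0 -> ~ congruent (real_of X) (real_of Y).
Proof.
move=> pq [nn _].
have [v nv] : exists v, dot n (q v - q x) <> 0.
  apply: contrapT => nex.
  have nx v : dot n (q v - q x) = 0 by apply: contrapT => ne; apply: nex; exists v.
  have n0 : n = 0.
    apply: (equivalent_spanning pq) => a b.
    have -> : q a - q b = (q a - q x) - (q b - q x) by rewrite opprB addrA subrK.
    by rewrite dotBr !nx subrr.
  by move: nn; rewrite n0 dot0l => /esym/eqP; rewrite oner_eq0.
have [df pf] := polyfun_base_dir v.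
have ne : dot (split_dir (mk_state 0 q n)) (split_base (mk_state 0 q n) v - split_base (mk_state 0 q n) x) !=
    dot (split_dir (mk_state 0 q (- n))) (split_base (mk_state 0 q (- n)) v - split_base (mk_state 0 q (- n)) x).
  rewrite !mk_state_base !mk_state_dir dotNl -subr_eq0 opprK -mulr2n mulrn_eq0 /=.
  exact/eqP.
have [r r0 rP] := polyfun_separate pf ne.
exists r => // X Y hX hY eE e0 /split_congruent_dir/(_ eE e0 v) E.
by have := rP X Y hX hY; rewrite E eqxx.
Qed.

Lemma rd_ge_split k : classes_ge G p k -> rd_ge R d G' (2 * k).
Proof.
move=> [q [pq nq]].
have [n nP] : {n & forall i, unit_normal (q i) (n i)}.
  exact: choice (fun i => unit_normal_exists (q i)).
pose T : finType := ('I_k * bool)%type.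
pose nrm (t : T) : 'rV[R]_d := if t.2 then n t.1 else - n t.1.
pose X0 (t : T) : state_index d V -> R := mk_state 0 (q t.1) (nrm t).
have nrmP t : unit_normal (q t.1) (nrm t).
  rewrite /nrm; have [nn nW] := nP t.1; case: t.2 => //; split=> [|y yW].
    by rewrite dotNl dotNr opprK.
  by rewrite dotNl nW // oppr0.
have [r r0 sep] : exists2 r, 0 < r & forall tt : T * T, tt.1 != tt.2 ->
    forall X Y : state_index d V -> R,
    bounded_by (fun j => X j - X0 tt.1 j) r ->
    bounded_by (fun j => Y j - X0 tt.2 j) r ->
    X None = Y None -> X None != 0 -> ~ congruent (real_of X) (real_of Y).
  apply: fin_radius => [tt a b _ ab H ne X Y hX hY|[[i s] [i' s']] /=].
    by apply: H => // j; [apply: le_trans (hX j) ab | apply: le_trans (hY j) ab].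
  have [ii'|ii'] := eqVneq i i'; last first.
    have [r r0 rP] := separate_distances (nrm (i, s)) (nrm (i', s')) (pq i) (nq i i' ii').
    by exists r => // _ X Y hX hY _ _; exact: rP.
  rewrite -ii'; have nE s0 : nrm (i, ~~ s0) = - nrm (i, s0).
    by rewrite /nrm /=; case: s0; rewrite /= ?opprK.
  have [r r0 rP] := separate_normals (pq i) (nrmP (i, s)).
  exists r => // ss' X Y hX hY; apply: rP => //.
  have -> : - nrm (i, s) = nrm (i, s').
    by rewrite -nE; congr (nrm (i, _)); case: s s' ss' {hX hY} => -[]; rewrite ?eqxx.
  exact: hY.
have [dl dl0 solv] : exists2 dl, 0 < dl & forall (t : T) (y : split_equation_index G W -> R),
    bounded_by (fun i => y i - split_equation x N2 i (X0 t)) dl ->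
    exists2 X : state_index d V -> R, forall i, split_equation x N2 i X = y i &
      bounded_by (fun j => X j - X0 t j) r.
  apply: fin_radius => [t a b _ ab H y hy|t].
    by apply: H => i; apply: le_trans (hy i) ab.
  exact: split_solvable (pq t.1) (nrmP t) r0.
have [n0 n0P] := unit_normal_exists p.
pose Z0 : state_index d V -> R := mk_state 0 p n0.
(* All [2 * k] initial states have the same right-hand side as [Z0], so a single perturbation of
   [Z0] serves them all. *)
have Z0E t i : split_equation x N2 i (X0 t) = split_equation (G := G) (W := W) x N2 i Z0.
  have [nn nW] := nrmP t; have [nn0 nW0] := n0P.
  apply/esym; exact: (split_equation_initial N2 i (pq t.1)).
have [e e0 near0] : exists2 e, 0 < e & forall (i : split_equation_index G W) Z,
    bounded_by (fun j => Z j - Z0 j) e ->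
    `|split_equation x N2 i Z - split_equation x N2 i Z0| <= dl.
  apply: fin_radius => [i a b _ ab H Z hZ|i].
    by apply: H => j; apply: le_trans (hZ j) ab.
  by have [e e0 H] := polyfun_continuous (@polyfun_split_equation R d V G x N2 W i) Z0 dl0; exists e.
pose c : realisation R d (option V) := fun a =>
  match a with Some v => p v | None => p x + e *: n0 end.
(* The direction in [Z] is obtained by dividing a difference by [e], so two errors of [e ^+ 2 / 2]
   become an error of [e]. *)
pose eta := Num.min e (e ^+ 2 / 2).
have eta0 : 0 < eta by rewrite lt_min e0 /= divr_gt0 // exprn_gt0.
have [p' gp' p'c] := generic_near c eta0.
pose Z : state_index d V -> R :=
  mk_state e (fun v => p' (Some v)) (e^-1 *: (p' None - p' (Some x))).
have ZE : real_of Z = p' by apply: split_realisationK; rewrite gt_eqF.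
have hZ : bounded_by (fun j => Z j - Z0 j) e.
  have eta1 : eta <= e by rewrite /eta ge_min lexx.
  have eta2 : eta <= e ^+ 2 / 2 by rewrite /eta ge_min lexx orbT.
  move=> [[[v|] l]|] /=; last by rewrite subr0 gtr0_norm.
    by apply: le_trans eta1; exact: (p'c (Some v) l).
  have := p'c None l; have := p'c (Some x) l; rewrite /c !mxE => A B.
  have -> : e^-1 * (p' None 0 l - p' (Some x) 0 l) - n0 0 l =
      e^-1 * ((p' None 0 l - (p x 0 l + e * n0 0 l)) - (p' (Some x) 0 l - p x 0 l)).
    by field; rewrite gt_eqF.
  rewrite normrM gtr0_norm ?invr_gt0 // mulrC ler_pdivrMr // -expr2.
  apply: le_trans (ler_normB _ _) _; lra.
have sol t : exists X : state_index d V -> R,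
    (forall i, split_equation (G := G) (W := W) x N2 i X = split_equation x N2 i Z) /\
    bounded_by (fun j => X j - X0 t j) r.
  have [|X XE hX] := solv t (fun i => split_equation x N2 i Z); last by exists X.
  by move=> i; rewrite Z0E; exact: near0.
have [X XP] := choice sol.
exists p'; split=> //.
have <- : #|T| = (2 * k)%N by rewrite card_prod card_ord card_bool mulnC.
apply: (classes_ge_fin (q := fun t => real_of (X t))) => [t|t t' tt'].
  rewrite -ZE; apply: (equal_equations_equivalent Gsym Girr part) => i.
  by have [-> _] := XP t.
have [E1 h1] := XP t; have [E2 h2] := XP t'.
apply: (sep (t, t') tt') => //; first exact: etrans (E1 None) (esym (E2 None)).
by have /= -> := E1 None; rewrite gt_eqF.
Qed.

End Doubling.

Theorem theorem4p13 (R : realType) (d : nat) (V : finType) (G : rel V)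
  (x : V) (N1 N2 W : {set V}) :
  (0 < d)%N -> symmetric G -> irreflexive G ->
  min_d_rigid R d G -> (d.+1 <= #|V|)%N ->
  split_partition G d x N1 N2 W ->
  forall k : nat, rd_ge R d G k ->
    rd_ge R d (vertex_split G x N1 N2 W) (2 * k).
Proof.
move=> d0 Gsym Girr Gmin dV part k [p [gp pk]].
exact: (rd_ge_split d0 Gsym Girr Gmin dV part gp pk).
Qed.
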